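(* Let $d$ be a positive odd integer. Let $\mu_0,\mu_1,\ldots,\mu_d$ be $d+1$ finite absolutely continuous moving measures on $\mathbb{R}^d$. Then at least one of the following holds: (i) there exists a unit vector $v\in\mathbb{R}^d$ such that all of $\mu_0,\ldots,\mu_d$ have the same median speed in the direction $v$; or (ii) there exist a time $t\in(-\infty,\infty)$ and a hyperplane $S_{d-1}\subset\mathbb{R}^d$ such that its two closed half-spaces $S_{d-1}^+,S_{d-1}^-$ satisfy \[ \mu_{i,t}(S_{d-1}^+)=\mu_{i,t}(S_{d-1}^-)\qquad\text{for each } i=0,1,\ldots,d. \]
   Context: $A_1(\mathbb{R}^{d+1})$ is the space of lines (1-dimensional affine subspaces) of $\mathbb{R}^{d+1}$. Via the natural embedding $A_1(\mathbb{R}^{d+1})\hookrightarrow G_2(\mathbb{R}^{d+2})$ (sending $\ell$ to the linear span of $\ell\times\{1\}$) into the Grassmannian of 2-dimensional linear subspaces, $A_1(\mathbb{R}^{d+1})$ inherits a measure from the measure on $G_2(\mathbb{R}^{d+2})$ induced by the Haar measure of the orthogonal group $O(d+2)$. A measure on $A_1(\mathbb{R}^{d+1})$ is absolutely continuous if it is absolutely continuous with respect to this measure. A finite absolutely continuous moving measure on $\mathbb{R}^d$ is a finite absolutely continuous measure $\mu$ on $A_1(\mathbb{R}^{d+1})$. Every line $\ell\subset\mathbb{R}^{d+1}$ not orthogonal to $e_{d+1}$ corresponds to a pair $(p,w)\in\mathbb{R}^d\times\mathbb{R}^d$ via $\ell=\{(p+tw,t):t\in\mathbb{R}\}$ (a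 point moving with constant velocity $w$, at position $p+tw$ at time $t$); lines orthogonal to $e_{d+1}$ have measure zero, so $\mu$ is regarded as a measure on $\mathbb{R}^d\times\mathbb{R}^d$. For $t\in\mathbb{R}$, $\mu_t$ (written $\mu_{i,t}$ for $\mu_i$) is the measure induced on the hyperplane $\{x\in\mathbb{R}^{d+1}:\langle x,e_{d+1}\rangle=t\}\cong\mathbb{R}^d$, i.e. $\mu_t(C)=\mu\{(p,w): p+tw\in C\}$ for measurable $C\subset\mathbb{R}^d$. For a unit vector $v\in\mathbb{R}^d$, the median speed of $\mu$ in the direction $v$ is the value $m\in\mathbb{R}$ for which $\mu\{(p,w):\langle w,v\rangle\le m\}=\mu\{(p,w):\langle w,v\rangle\ge m\}$. That all measures have the same median speed in the direction $v$ means that one common value $m$ satisfies this equality for every one of the measures. *)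

(* Defs.v *)
From HB Require Import structures.
From mathcomp Require Import all_boot all_order all_algebra.
From mathcomp Require Import all_classical all_reals all_analysis.
Set Implicit Arguments.
Unset Strict Implicit.
Unset Printing Implicit Defensive.
Import Order.TTheory GRing.Theory Num.Theory.
Import numFieldNormedType.Exports.
Local Open Scope classical_set_scope.
Local Open Scope ring_scope.

(* The library norm on 'rV[R]_n is the sup norm, so Euclidean notions are
   stated with this inner product; a unit vector is a v with dot v v = 1. *)
Definition dot (R : realType) (n : nat) (u v : 'rV[R]_n) : R :=
  \sum_i u 0 i * v 0 i.

(* (x_1, ..., x_n, t) : the last coordinate is the one along e_{n+1}. *)
Definition append (R : realType) (n : nat) (x : 'rV[R]_n) (t : R) :
    'rV[R]_n.+1 :=
  \row_i oapp (x 0) t (unlift ord_max i).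

Lemma append_linear (R : realType) (n : nat) (x y : 'rV[R]_n) (a b s : R) :
  append (x + s *: y) (a + s * b) = append x a + s *: append y b.
Proof. by apply/rowP => i; rewrite !mxE; case: unlift => //= j; rewrite !mxE. Qed.

Lemma append_lift (R : realType) (n : nat) (x : 'rV[R]_n) (t : R) (i : 'I_n) :
  append x t 0 (lift ord_max i) = x 0 i.
Proof. by rewrite mxE liftK. Qed.

Lemma append_max (R : realType) (n : nat) (x : 'rV[R]_n) (t : R) :
  append x t 0 ord_max = t.
Proof. by rewrite mxE unlift_none. Qed.

Definition borel (T : topologicalType) : Type := g_sigma_algebraType (@open T).

HB.instance Definition _ (T : ptopologicalType) :=
  Measurable.copy (borel T) (g_sigma_algebraType (@open T)).

(* O(n), with the topology induced from the space of matrices. *)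
Definition orth_group (R : realType) (n : nat) : Type :=
  set_type [set g : 'M[R]_n | g *m g^T = 1%:M].

HB.instance Definition _ (R : realType) (n : nat) :=
  Topological.copy (orth_group R n)
    (set_type [set g : 'M[R]_n | g *m g^T = 1%:M]).

Definition mkorth (R : realType) (n : nat) (g : 'M[R]_n)
  (gP : g *m g^T = 1%:M) : orth_group R n := SigSub (mem_set gP).

Lemma orthP (R : realType) (n : nat) (g : orth_group R n) :
  val g *m (val g)^T = 1%:M.
Proof. exact: (set_mem (valP g)). Qed.

Lemma orth1_subproof (R : realType) (n : nat) :
  1%:M *m (1%:M)^T = 1%:M :> 'M[R]_n.
Proof. by rewrite trmx1 mulmx1. Qed.

HB.instance Definition _ (R : realType) (n : nat) :=
  isPointed.Build (orth_group R n) (mkorth (orth1_subproof R n)).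

Lemma orthM_subproof (R : realType) (n : nat) (g h : orth_group R n) :
  (val g *m val h) *m (val g *m val h)^T = 1%:M.
Proof. by rewrite trmx_mul mulmxA -(mulmxA (val g)) orthP mulmx1 orthP. Qed.

Definition orth_mul (R : realType) (n : nat) (g h : orth_group R n) :
  orth_group R n := mkorth (orthM_subproof g h).

(* The Haar measure of the compact group O(n) is the unique probability
   measure satisfying this property. *)
Definition is_haar (R : realType) (n : nat)
    (haar : probability (borel (orth_group R n)) R) : Prop :=
  forall (g : orth_group R n) (A : set (borel (orth_group R n))),
    measurable A -> haar (orth_mul g @^-1` A) = haar A.

(* The index n stands for G_2(R^{n+2}); likewise line R d below is
   A_1(R^{d+1}), which embeds into grass2 R d. *)
Definition grass2 (R : realType) (n : nat) : Type :=
  {U : {vspace 'rV[R]_n.+2} | \dim U == 2%N}.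

HB.instance Definition _ (R : realType) (n : nat) :=
  SubChoice.copy (grass2 R n) {U : {vspace 'rV[R]_n.+2} | \dim U == 2%N}.

Definition base_plane (R : realType) (n : nat) : {vspace 'rV[R]_n.+2} :=
  <<[:: delta_mx 0 ord0; delta_mx 0 (lift ord0 ord0)]%R>>%VS.

Lemma dim_base_plane (R : realType) (n : nat) : \dim (base_plane R n) == 2%N.
Proof.
suff : free [:: delta_mx 0 ord0; delta_mx 0 (lift ord0 ord0) : 'rV[R]_n.+2].
  by [].
rewrite free_cons seq1_free span_seq1; apply/andP; split.
  apply/negP => /vlineP[k] /rowP/(_ ord0); rewrite !mxE /= mulr0 => /eqP.
  by rewrite oner_eq0.
apply/eqP => /rowP/(_ (lift ord0 ord0)); rewrite !mxE /= => /eqP.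
by rewrite oner_eq0.
Qed.

HB.instance Definition _ (R : realType) (n : nat) :=
  isPointed.Build (grass2 R n) (Sub (base_plane R n) (dim_base_plane R n)).

(* g acts on (row) vectors by x |-> g x, i.e. x *m g^T. *)
Lemma dim_orth_image (R : realType) (n : nat) (g : orth_group R n)
    (U : {vspace 'rV[R]_n}) :
  \dim (linfun (mulmxr (val g)^T) @: U)%VS = \dim U.
Proof.
apply: limg_dim_eq; apply/eqP; rewrite -subv0; apply/subvP => x.
rewrite memv_cap memv_ker lfunE /= memv0 => /andP[_ /eqP xg0].
by rewrite -[x]mulmx1 -(mulmx1C (orthP g)) mulmxA xg0 mul0mx.
Qed.

Lemma grass2_orbit_subproof (R : realType) (n : nat) (g : orth_group R n.+2) :
  \dim (linfun (mulmxr (val g)^T) @: base_plane R n)%VS == 2%N.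
Proof. by rewrite dim_orth_image dim_base_plane. Qed.

Definition grass2_orbit (R : realType) (n : nat) (g : orth_group R n.+2) :
  grass2 R n := Sub (linfun (mulmxr (val g)^T) @: base_plane R n)%VS
                    (grass2_orbit_subproof g).

(* The topology of G_2(R^{n+2}) as a homogeneous space: the quotient topology
   for the orbit map of a fixed plane. *)
Definition grass2_open (R : realType) (n : nat) : set_system (grass2 R n) :=
  [set U | open (@grass2_orbit R n @^-1` U)].

Lemma grass2_openT (R : realType) (n : nat) : @grass2_open R n setT.
Proof. by rewrite /grass2_open /= preimage_setT; exact: openT. Qed.

Lemma grass2_openI (R : realType) (n : nat) : setI_closed (@grass2_open R n).
Proof. by move=> A B oA oB; exact: openI. Qed.

Lemma grass2_open_bigU (R : realType) (n : nat) (I : Type)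
    (F : I -> set (grass2 R n)) :
  (forall i, grass2_open (F i)) -> grass2_open (\bigcup_i F i).
Proof.
by move=> oF; rewrite /grass2_open /= preimage_bigcup; apply: bigcup_open => i _;
  exact: oF.
Qed.

HB.instance Definition _ (R : realType) (n : nat) :=
  isOpenTopological.Build (grass2 R n) (@grass2_openT R n) (@grass2_openI R n)
    (@grass2_open_bigU R n).

Definition grass2_measure (R : realType) (n : nat)
    (haar : probability (borel (orth_group R n.+2)) R) :
    set (borel (grass2 R n)) -> \bar R :=
  pushforward haar (@grass2_orbit R n : borel _ -> borel _).

Definition is_line (R : realType) (n : nat) (l : set 'rV[R]_n) : Prop :=
  exists x u : 'rV[R]_n, u != 0 /\ l = [set x + s *: u | s in setT].

Definition line (R : realType) (d : nat) : Type :=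
  set_type [set l : set 'rV[R]_d.+1 | is_line l].

HB.instance Definition _ (R : realType) (d : nat) :=
  SubChoice.copy (line R d) (set_type [set l : set 'rV[R]_d.+1 | is_line l]).

Definition mkline (R : realType) (d : nat) (l : set 'rV[R]_d.+1)
  (lP : is_line l) : line R d := SigSub (mem_set lP).

Lemma lineP (R : realType) (d : nat) (l : line R d) : is_line (val l).
Proof. exact: (set_mem (valP l)). Qed.

(* The line {(p + t w, t) : t}. *)
Lemma worldline_subproof (R : realType) (d : nat) (p w : 'rV[R]_d) :
  is_line [set append (p + t *: w) t | t in setT].
Proof.
exists (append p 0), (append w 1); split.
  apply/eqP => /rowP/(_ ord_max); rewrite append_max mxE => /eqP.
  by rewrite oner_eq0.
congr image; apply/funext => t.
by rewrite -append_linear add0r mulr1.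
Qed.

Definition worldline (R : realType) (d : nat) (p w : 'rV[R]_d) : line R d :=
  mkline (worldline_subproof p w).

HB.instance Definition _ (R : realType) (d : nat) :=
  isPointed.Build (line R d) (worldline 0 0).

Definition is_lin_span (R : realType) (n : nat) (S : set 'rV[R]_n)
    (U : {vspace 'rV[R]_n}) : Prop :=
  (forall x, S x -> x \in U) /\
  (forall W : {vspace 'rV[R]_n}, (forall x, S x -> x \in W) -> (U <= W)%VS).

Definition lin_span (R : realType) (n : nat) (S : set 'rV[R]_n) :
  {vspace 'rV[R]_n} := xget 0%VS [set U | is_lin_span S U].

Lemma lin_span_eq (R : realType) (n : nat) (S : set 'rV[R]_n)
  (U : {vspace 'rV[R]_n}) : is_lin_span S U -> lin_span S = U.
Proof.
move=> SU; rewrite /lin_span; case: xgetP => [W _ [SW leW]|/(_ U)//].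
case: SU => SU leU; apply/eqP; rewrite eqEsubv.
by rewrite leW//= leU.
Qed.

(* l x {1} *)
Definition lift1 (R : realType) (n : nat) (l : set 'rV[R]_n) :
  set 'rV[R]_n.+1 := [set append x 1 | x in l].

Lemma lin_span_line (R : realType) (n : nat) (x u : 'rV[R]_n) :
  lin_span (lift1 [set x + s *: u | s in setT]) =
  <<[:: append u 0; append x 1]%R>>%VS.
Proof.
apply: lin_span_eq; split => [_ [_ [s _ <-] <-]|W lW].
  have -> : append (x + s *: u) 1 = append x 1 + s *: append u 0.
    by rewrite -append_linear mulr0 addr0.
  rewrite memvD//.
    by rewrite memv_span// !inE eqxx orbT.
  by rewrite memvZ// memv_span// !inE eqxx.
have xW : append x 1 \in W.
  by apply: lW; exists x => //; exists 0 => //; rewrite scale0r addr0.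
apply/span_subvP => y; rewrite !inE => /orP[]/eqP->//.
have : append (x + 1 *: u) (1 + 1 * 0) \in W.
  apply: lW; exists (x + 1 *: u); last by rewrite mulr0 addr0.
  by exists 1.
by rewrite append_linear scale1r rpredDl.
Qed.

Lemma line_plane_subproof (R : realType) (d : nat) (l : line R d) :
  \dim (lin_span (lift1 (val l))) == 2%N.
Proof.
case: (lineP l) => x [u [u0 ->]]; rewrite lin_span_line.
suff : free [:: append u 0; append x 1] by [].
rewrite free_cons seq1_free span_seq1; apply/andP; split; last first.
  apply/eqP => /rowP/(_ ord_max); rewrite append_max mxE => /eqP.
  by rewrite oner_eq0.
apply/negP => /vlineP[k] e; move: (e) => /rowP/(_ ord_max).
rewrite append_max mxE append_max mulr1 => k0.
move: u0; rewrite -k0 scale0r in e; move/negP; apply; apply/eqP/rowP => i.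
by rewrite -(append_lift u 0) e !mxE.
Qed.

Definition line_plane (R : realType) (d : nat) (l : line R d) : grass2 R d :=
  Sub (lin_span (lift1 (val l))) (line_plane_subproof l).

HB.instance Definition _ (R : realType) (d : nat) :=
  Topological.copy (line R d) (initial_topology (@line_plane R d)).

(* The embedding line_plane is injective with open image, so this is the
   restriction of the measure on the Grassmannian to the space of lines. *)
Definition line_measure (R : realType) (d : nat)
    (haar : probability (borel (orth_group R d.+2)) R)
    (A : set (borel (line R d))) : \bar R :=
  grass2_measure haar (@line_plane R d @` A).

(* mu regarded as a measure on pairs (position at time 0, velocity). *)
Definition phase (R : realType) (d : nat)
    (mu : {finite_measure set (borel (line R d)) -> \bar R})
    (A : set ('rV[R]_d * 'rV[R]_d)) : \bar R :=
  mu [set worldline pw.1 pw.2 | pw in A].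

Definition at_time (R : realType) (d : nat)
    (mu : {finite_measure set (borel (line R d)) -> \bar R}) (t : R)
    (C : set 'rV[R]_d) : \bar R :=
  phase mu [set pw | C (pw.1 + t *: pw.2)].

Definition is_median_speed (R : realType) (d : nat)
    (mu : {finite_measure set (borel (line R d)) -> \bar R})
    (v : 'rV[R]_d) (m : R) : Prop :=
  phase mu [set pw | dot pw.2 v <= m] = phase mu [set pw | m <= dot pw.2 v].

(* Main.v *)
(** Write (a1, a2) = (cos (pi t), sin (pi t)) and let F_i (t, c, n) be the
    difference of the mu_i-measures of the two open sides of the affine
    hyperplane <n, a1 p + a2 w> = c of phase space.  A common zero of the F_i
    with n <> 0 is what is wanted: a1 = 0 gives the first alternative and
    a1 <> 0 the second one, at time a2 / a1.  A common zero with n = 0 means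
    that all the measures vanish.

    F is continuous off (c, n) = 0, because these hyperplanes are null:
    in Pluecker coordinates they are linear, and if a linear form vanishes at g
    for a set of positive Haar measure of g, then, by invariance, almost all
    these g annihilate its rotations in every coordinate plane too.

    F is odd in (c, n), and F (t + 1, c, n) = - F (t, - c, n).  Such a map from
    R x S^d to R^(d+1) has a zero when d is odd.  Otherwise label each vertex of
    a fine triangulation by the index of the largest coordinate of F and its
    sign; no edge has opposite labels.  Mod 2, the number of simplices of a
    chain whose labels, in increasing order, alternate in sign is, as in Ky
    Fan's lemma, the number of those simplices of its boundary that alternate
    and start with +.  Applied to hemispheres H_k and to the prisms
    P_k = [0, 1] x H_k, with boundary {0, 1} x H_k + P_(k-1) + (- P_(k-1)),
    this gives k alternating simplices in P_k, mod 2.  For k = d this is an odd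
    number, yet labels with d + 1 indices cannot alternate on d + 2 vertices. *)

Require Import Defs.
From HB Require Import structures.
From mathcomp Require Import all_boot all_order all_algebra.
From mathcomp Require Import all_classical all_reals all_analysis.
From mathcomp Require Import ring lra.
Set Implicit Arguments.
Unset Strict Implicit.
Unset Printing Implicit Defensive.
Import Order.TTheory GRing.Theory Num.Theory.
Import numFieldNormedType.Exports.
Local Open Scope classical_set_scope.
Local Open Scope ring_scope.

(** * Simplicial chains modulo 2 and alternating labels *)

Definition xsum (T : Type) (c : seq T) (f : T -> bool) : bool :=
  \big[addb/false]_(s <- c) f s.

(** Chains modulo 2 are lists in which repetitions cancel in pairs; testing them against all boolean
    functions avoids a normal form. *)
Definition chain_eq (T : Type) (c c' : seq T) := xsum c =1 xsum c'.

Section Xsum.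
Variables T U : Type.

Lemma xsum_nil (f : T -> bool) : xsum [::] f = false.
Proof. by rewrite /xsum big_nil. Qed.

Lemma xsum1 (x : T) (f : T -> bool) : xsum [:: x] f = f x.
Proof. by rewrite /xsum big_seq1. Qed.

Lemma xsum_cons (x : T) c (f : T -> bool) :
  xsum (x :: c) f = f x (+) xsum c f.
Proof. by rewrite /xsum big_cons. Qed.

Lemma xsum_cat (c c' : seq T) (f : T -> bool) :
  xsum (c ++ c') f = xsum c f (+) xsum c' f.
Proof. by rewrite /xsum big_cat. Qed.

Lemma xsum_map (g : T -> U) (c : seq T) (f : U -> bool) :
  xsum (map g c) f = xsum c (f \o g).
Proof. by rewrite /xsum big_map. Qed.

Lemma xsum_flatten (g : T -> seq U) (c : seq T) (f : U -> bool) :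
  xsum (flatten (map g c)) f = xsum c (fun s => xsum (g s) f).
Proof.
elim: c => [|s c IH] /=; first by rewrite /xsum !big_nil.
by rewrite /xsum big_cat big_cons; congr addb.
Qed.

Lemma xsumD (c : seq T) (f g : T -> bool) :
  xsum c (fun s => f s (+) g s) = xsum c f (+) xsum c g.
Proof. by rewrite /xsum big_split. Qed.

Lemma eq_xsum (c : seq T) (f g : T -> bool) :
  f =1 g -> xsum c f = xsum c g.
Proof. by move=> fg; apply: eq_bigr => s _; exact: fg. Qed.

End Xsum.

Lemma eq_xsum_in (T : eqType) (c : seq T) (f g : T -> bool) :
  {in c, f =1 g} -> xsum c f = xsum c g.
Proof.
by move=> fg; rewrite /xsum big_seq [RHS]big_seq; apply: eq_bigr => s; exact: fg.
Qed.

Section Chain.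
Variable V : eqType.
Implicit Types (s : seq V) (c : seq (seq V)) (f : seq V -> bool).

(* The faces of a simplex, given by the list of its vertices; the empty
   simplex is the face of every vertex, so that chains are augmented. *)
Fixpoint faces s : seq (seq V) :=
  if s is v :: s' then s' :: map (cons v) (faces s') else [::].

Definition bd c := flatten (map faces c).

Lemma xsum_bd c f : xsum (bd c) f = xsum c (fun s => xsum (faces s) f).
Proof. exact: xsum_flatten. Qed.

Lemma bd_cat c c' : bd (c ++ c') = bd c ++ bd c'.
Proof. by rewrite /bd map_cat flatten_cat. Qed.

Lemma bd_cone v c : chain_eq (bd (map (cons v) c)) (c ++ map (cons v) (bd c)).
Proof.
move=> f; rewrite xsum_bd xsum_map xsum_cat xsum_map xsum_bd -xsumD.
by apply: eq_xsum => s /=; rewrite xsum_cons xsum_map.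
Qed.

(** By [bd_cone], the boundary of the facets of [v :: s] is the facets of [s] twice, plus a cone
    over the chain of the induction hypothesis. *)
Lemma bd_faces s f : xsum (bd (faces s)) f = false.
Proof.
elim: s f => [|v s IH] f; first by rewrite xsum_bd xsum_nil.
rewrite /= /bd /= -/(bd _) xsum_cat bd_cone xsum_cat xsum_map IH addbF.
exact: addbb.
Qed.

Lemma mem_faces s t v : t \in faces s -> v \in t -> v \in s.
Proof.
elim: s t => //= w s IH t; rewrite !inE => /orP[/eqP->->|]; first exact: orbT.
case/mapP => u us ->; rewrite inE => /orP[->//|/(IH _ us)->].
exact: orbT.
Qed.

Lemma size_faces s t : t \in faces s -> size s = (size t).+1.
Proof.
elim: s t => //= w s IH t; rewrite !inE => /orP[/eqP->//|].
by case/mapP => u us -> /=; rewrite (IH _ us).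
Qed.

(** [rem] deletes the first occurrence only, so at a repeated vertex it yields the intended face up
    to order, which [f] ignores. *)
Lemma faces_perm (f : seq V -> bool) s :
  (forall u v, perm_eq u v -> f u = f v) ->
  xsum (faces s) f = xsum s (fun v => f (rem v s)).
Proof.
elim: s f => [|w s IH] f fP; first by rewrite /xsum !big_nil.
rewrite /= !xsum_cons eqxx; congr addb; rewrite xsum_map (IH (f \o cons w)).
  apply: eq_xsum_in => v vs /=; case: eqVneq => // wv.
  by apply: fP; rewrite -wv in vs *; rewrite perm_sym perm_to_rem.
by move=> u v uv /=; apply: fP; rewrite perm_cons.
Qed.

Lemma perm_faces f s t : (forall u v, perm_eq u v -> f u = f v) ->
  perm_eq s t -> xsum (faces s) f = xsum (faces t) f.
Proof.
move=> fP st; rewrite !faces_perm// /xsum (perm_big _ st) /=.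
rewrite big_seq [RHS]big_seq; apply: eq_bigr => v vt; apply: fP.
have vs : v \in s by rewrite (perm_mem st).
rewrite -(perm_cons v) (permPl (_ : perm_eq _ s)); last first.
  by rewrite perm_sym perm_to_rem.
by rewrite (permPl st) perm_to_rem.
Qed.

End Chain.

Lemma faces_map (V W : eqType) (g : V -> W) s :
  faces (map g s) = map (map g) (faces s).
Proof. by elim: s => //= v s ->; rewrite -!map_comp. Qed.

Section Labels.

Fixpoint alt (b : bool) (s : seq bool) :=
  if s is x :: s' then (x == b) && alt (~~ b) s' else true.

(** A list alternating from [b] stays so only if its last entry is deleted, and one alternating from
    [~~ b] becomes so only if its first is. Any other list has equal neighbours; a deletion can make
    it alternate only by removing one of these, and both choices give the same list. *)
Lemma alt_faces b x s :
  xsum (faces (x :: s)) (alt b) = alt b (x :: s) (+) alt (~~ b) (x :: s).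
Proof.
elim: s b x => [|y s IH] b x; first by rewrite xsum1 /=; case: x; case: b.
have -> : faces [:: x, y & s] = (y :: s) :: map (cons x) (faces (y :: s)) by [].
rewrite xsum_cons xsum_map.
have -> : xsum (faces (y :: s)) (alt b \o cons x) =
    (x == b) && xsum (faces (y :: s)) (alt (~~ b)).
  case: (eqVneq x b) => [->|xb] /=.
    by apply: eq_xsum => u /=; rewrite eqxx.
  rewrite (@eq_xsum _ _ _ (fun=> false)) ?/xsum ?big1// => u /=.
  by rewrite (negbTE xb).
rewrite IH /= ?negbK; case: x; case: b; case: y => //=;
  by case: (alt true s) => //; case: (alt false s).
Qed.

(* The label 2 i + b stands for the vertex +- e_i of the cross-polytope. *)
Definition flip (n : nat) : nat := if odd n then n.-1 else n.+1.

Lemma odd_flip n : odd (flip n) = ~~ odd n.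
Proof. by case: n => // n; rewrite /flip /=; case: (boolP (odd n)) => /= [->|/negbTE->]. Qed.

Lemma half_flip n : (flip n)./2 = n./2.
Proof.
rewrite /flip; case: ifP => [|/negbT on].
  by case: n => //= n; rewrite uphalf_half => /negbTE->.
by rewrite /= uphalf_half (negbTE on).
Qed.

Lemma eq_half_odd x y : x./2 = y./2 -> odd x = odd y -> x = y.
Proof. by move=> h o; rewrite -[x]odd_double_half -[y]odd_double_half h o. Qed.

Definition alternates (b : bool) (s : seq nat) := alt b (map odd (sort leq s)).

Lemma perm_alternates b s t :
  perm_eq s t -> alternates b s = alternates b t.
Proof.
move=> /(perm_sortP leq_total leq_trans anti_leq) st.
by rewrite /alternates st.
Qed.

(** Both sides ignore the order of [s], so [s] may be sorted. Its faces are then sorted too, and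
    [alt_faces] applies to the parities. *)
Lemma alternates_faces s : (0 < size s)%N ->
  xsum (faces s) (alternates true) = alternates true s (+) alternates false s.
Proof.
move=> s0; rewrite (@perm_faces _ _ _ (sort leq s)); last 2 first.
- exact: perm_alternates.
- by rewrite perm_sym perm_sort.
have ss : sorted leq (sort leq s) by rewrite sort_sorted//; exact: leq_total.
transitivity (xsum (faces (sort leq s)) (alt true \o map odd)).
  apply: eq_xsum_in => t tf; rewrite /= /alternates sorted_sort//.
    exact: leq_trans.
  apply: subseq_sorted ss; first exact: leq_trans.
  elim: (sort leq s) t tf => //= v u IH t.
  rewrite inE => /orP[/eqP->|/mapP[w /IH wu ->]]; first exact: subseq_cons.
  by rewrite /= eqxx.
rewrite -xsum_map -faces_map /alternates.
case E : (map odd (sort leq s)) => [|x u]; last exact: alt_faces.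
by move: s0; rewrite -(size_sort leq) -(size_map odd) E.
Qed.

Definition coherent (s : seq nat) :=
  {in s &, forall x y, x./2 = y./2 -> x = y}.

(** [flip] only exchanges [2 i] and [2 i + 1]. A coherent list has at most one of the two, so [flip]
    preserves the sorted order and reverses every parity. *)
Lemma alternates_flip b s : coherent s ->
  alternates b (map flip s) = alternates (~~ b) s.
Proof.
move=> cs; rewrite /alternates.
have -> : sort leq (map flip s) = map flip (sort leq s).
  apply: (sorted_eq leq_trans anti_leq).
  - by rewrite sort_sorted//; exact: leq_total.
  - have := sort_sorted leq_total s.
    have : {subset sort leq s <= s} by move=> x; rewrite mem_sort.
    elim: (sort leq s) => //= x u IH us; rewrite !path_sortedE; last 2 first.
    + exact: leq_trans.
    + exact: leq_trans.
    case/andP => /allP xu su; apply/andP; split.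
      apply/allP => _ /mapP[y yu ->].
      have := xu _ yu; rewrite leq_eqVlt => /orP[/eqP->//|xy].
      have : (x./2 <= y./2)%N by apply: half_leq; exact: ltnW.
      rewrite leq_eqVlt => /orP[/eqP/cs xyE|xy2].
        move: xy; rewrite xyE ?ltnn// us// !inE ?eqxx// yu orbT//.
      rewrite -[flip x]odd_double_half -[flip y]odd_double_half !half_flip.
      rewrite (@leq_trans (x./2).+1.*2)//.
        by rewrite doubleS; case: odd => //=; rewrite ltnW.
      by rewrite (leq_trans _ (leq_addl _ _))// leq_double.
    by apply: IH => // y yu; rewrite us// inE yu orbT.
  - by rewrite perm_sort perm_map// perm_sym perm_sort.
rewrite -map_comp; elim: (sort leq s) b => //= x u IH b.
by rewrite IH odd_flip; case: b; case: odd.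
Qed.

(** Equal labels would be neighbours after sorting and break the alternation, so the labels are
    distinct. By coherence their halves are distinct too, and there are only [m] possible halves. *)
Lemma alternates_size b s m : coherent s -> all (fun x => x < m.*2)%N s ->
  (m < size s)%N -> alternates b s = false.
Proof.
move=> cs sm ms; apply/negbTE/negP => a.
have us : uniq s.
  rewrite -(sort_uniq leq); move: a; rewrite /alternates.
  have := sort_sorted leq_total s.
  have : {subset sort leq s <= s} by move=> x; rewrite mem_sort.
  elim: (sort leq s) b => //= x u IH b us.
  rewrite path_sortedE; last exact: leq_trans.
  case/andP => /allP xu su /andP[xb au]; apply/andP; split; last first.
    by apply: (IH (~~ b)) => // y yu; rewrite us// inE yu orbT.
  apply/negP => xinu; case: u IH us xu su au xinu => // y u IH us xu su.
  rewrite /= => /andP[yb _]; rewrite inE => /orP[/eqP xy|xinu].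
    by move: xb yb; rewrite xy => /eqP->; case: b.
  move: su => /=; rewrite path_sortedE; last exact: leq_trans.
  case/andP => /allP /(_ _ xinu) yx _.
  have yxE : y = x by apply: anti_leq; rewrite yx xu// mem_head.
  by move: xb yb; rewrite yxE => /eqP->; case: b.
have : uniq (map half s) by rewrite map_inj_in_uniq.
move/(@uniq_leq_size _ _ (iota 0 m)); rewrite size_map size_iota leqNgt ms.
move=> H; suff : false by []; apply: H => _ /mapP[x /(allP sm) xm ->].
by rewrite mem_iota add0n /= -ltn_double (leq_ltn_trans _ xm)//
  -[leqRHS]odd_double_half leq_addl.
Qed.

End Labels.

(** * Barycentric subdivision and the parity of a prism *)

Definition pure (V : eqType) n (c : seq (seq V)) := {in c, forall s, size s = n}.

Section Subdivision.
Variables (R : numFieldType) (V : lmodType R).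
Implicit Types (s : seq V) (c : seq (seq V)).

Definition barycenter s : V := (size s)%:R^-1 *: \sum_(v <- s) v.

(* The recursion is on n, which is meant to be the number of vertices of s. *)
Fixpoint subdiv1 n s : seq (seq V) :=
  if n is n'.+1 then
    map (cons (barycenter s)) (flatten (map (subdiv1 n') (faces s)))
  else [:: [::]].

Definition subdiv n c := flatten (map (subdiv1 n) c).

Lemma xsum_subdiv n c f :
  xsum (subdiv n c) f = xsum c (fun s => xsum (subdiv1 n s) f).
Proof. exact: xsum_flatten. Qed.

(** The cone formula leaves a cone over the boundary of the subdivided facets; by induction this is
    the subdivision of a double boundary, hence 0. *)
Lemma bd_subdiv1 n s : size s = n ->
  chain_eq (bd (subdiv1 n s)) (subdiv n.-1 (faces s)).
Proof.
elim: n s => [|n IH] s sn f.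
  by rewrite (size0nil sn) xsum_bd xsum1 /= /xsum !big_nil.
rewrite /= -/(subdiv n (faces s)) bd_cone xsum_cat.
rewrite [X in _ (+) X](_ : _ = false) ?addbF//.
rewrite xsum_map xsum_bd xsum_subdiv.
transitivity (xsum (bd (faces s)) (fun u => xsum (subdiv1 n.-1 u)
    (f \o cons (barycenter s)))); last exact: bd_faces.
rewrite xsum_bd; apply: eq_xsum_in => t /size_faces; rewrite sn => -[tn].
by rewrite -xsum_bd IH// xsum_subdiv.
Qed.

Lemma bd_subdiv n c : pure n c ->
  chain_eq (bd (subdiv n c)) (subdiv n.-1 (bd c)).
Proof.
move=> cn f; rewrite xsum_bd xsum_subdiv xsum_subdiv xsum_bd.
apply: eq_xsum_in => s /cn sn.
by rewrite -xsum_bd bd_subdiv1// xsum_subdiv.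
Qed.

Lemma pure_subdiv1 n s : pure n (subdiv1 n s).
Proof.
elim: n s => [|n IH] s t /=; first by rewrite inE => /eqP->.
case/mapP => u /flattenP[_ /mapP[w _ ->] uw] ->.
by rewrite /= (IH _ _ uw).
Qed.

Lemma pure_subdiv n c : pure n (subdiv n c).
Proof. by move=> t /flattenP[_ /mapP[w _ ->]]; exact: pure_subdiv1. Qed.

Lemma subdiv_eq n c c' : chain_eq c c' -> chain_eq (subdiv n c) (subdiv n c').
Proof. by move=> cc' f; rewrite !xsum_subdiv cc'. Qed.

Lemma subdiv_cat n c c' : subdiv n (c ++ c') = subdiv n c ++ subdiv n c'.
Proof. by rewrite /subdiv map_cat flatten_cat. Qed.

Definition isubdiv r n c := iter r (subdiv n) c.

Lemma pure_isubdiv r n c : pure n c -> pure n (isubdiv r n c).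
Proof. by case: r => //= r _; exact: pure_subdiv. Qed.

Lemma isubdiv_eq r n c c' :
  chain_eq c c' -> chain_eq (isubdiv r n c) (isubdiv r n c').
Proof. by move=> cc'; elim: r => //= r IH; exact: subdiv_eq. Qed.

Lemma bd_isubdiv r n c : pure n c ->
  chain_eq (bd (isubdiv r n c)) (isubdiv r n.-1 (bd c)).
Proof.
move=> cn; elim: r => //= r IH f.
by rewrite bd_subdiv ?(subdiv_eq _ IH)//; exact: pure_isubdiv.
Qed.

Lemma isubdiv_cat r n c c' :
  isubdiv r n (c ++ c') = isubdiv r n c ++ isubdiv r n c'.
Proof. by elim: r => //= r ->; exact: subdiv_cat. Qed.

Lemma subdiv1_ind (Q : V -> Prop) n s :
  (forall t, (0 < size t)%N -> {in t, forall v, Q v} -> Q (barycenter t)) ->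
  size s = n -> {in s, forall v, Q v} ->
  {in subdiv1 n s, forall t, {in t, forall v, Q v}}.
Proof.
move=> Qb; elim: n s => [|n IH] s sn Qs t /=; first by rewrite inE => /eqP->.
case/mapP => u /flattenP[_ /mapP[w ws ->] uw] -> v.
rewrite inE => /orP[/eqP->|vu]; first by apply: Qb => //; rewrite sn.
apply: IH uw _ vu.
  by move/size_faces: ws; rewrite sn => -[].
by move=> x xw; apply: Qs; exact: mem_faces ws xw.
Qed.

Lemma isubdiv_ind (Q : seq V -> Prop) r n c :
  (forall s, size s = n -> Q s -> {in subdiv1 n s, forall t, Q t}) ->
  pure n c -> {in c, forall s, Q s} -> {in isubdiv r n c, forall s, Q s}.
Proof.
move=> Qs cn Qc; elim: r => //= r IH t.
case/flattenP => _ /mapP[w ws ->]; apply: Qs; last exact: IH.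
exact: pure_isubdiv ws.
Qed.

Section Maps.
Variable g : V -> V.
Hypothesis gb : forall s, (0 < size s)%N ->
  g (barycenter s) = barycenter (map g s).

Lemma subdiv1_map n s : size s = n ->
  subdiv1 n (map g s) = map (map g) (subdiv1 n s).
Proof.
elim: n s => //= n IH s sn.
rewrite -gb ?sn// faces_map -map_comp.
transitivity (map (cons (g (barycenter s)))
    (map (map g) (flatten (map (subdiv1 n) (faces s))))); last first.
  by rewrite -!map_comp.
congr (map _ _); rewrite map_flatten -!map_comp; congr flatten.
by apply/eq_in_map => t /size_faces; rewrite sn => -[tn] /=; rewrite IH.
Qed.

Lemma isubdiv_map r n c : pure n c ->
  isubdiv r n (map (map g) c) = map (map g) (isubdiv r n c).
Proof.
move=> cn; elim: r => //= r ->; rewrite /subdiv map_flatten -!map_comp.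
congr flatten; apply/eq_in_map => s sc /=; rewrite subdiv1_map//.
exact: pure_isubdiv sc.
Qed.

End Maps.

End Subdivision.

(** * Fan's count for hemispheres and prisms *)

Section FanCount.
Variables (R : numFieldType) (V : lmodType R).
Variables (m : nat) (nu rho tau : V -> V) (e q : nat -> V).

(* In the application, nu is the antipode, tau a translation along the interval
   factor, and the e k are the vertices of a cross-polytope; then prism k
   triangulates the product of an interval and hemisphere k. *)
Fixpoint hemisphere k : seq (seq V) :=
  if k is k'.+1 then
    map (cons (e k)) (hemisphere k' ++ map (map nu) (hemisphere k'))
  else [:: [:: e 0]].

Fixpoint prism k : seq (seq V) :=
  map (cons (q k)) (map (map tau) (hemisphere k) ++ hemisphere k ++
    if k is k'.+1 then prism k' ++ map (map nu) (prism k') else [::]).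

Hypothesis nub : forall s, (0 < size s)%N ->
  nu (barycenter s) = barycenter (map nu s).
Hypothesis rhob : forall s, (0 < size s)%N ->
  rho (barycenter s) = barycenter (map rho s).
Hypothesis taub : forall s, (0 < size s)%N ->
  tau (barycenter s) = barycenter (map tau s).
Hypothesis nuK : involutive nu.
Hypothesis nutau : forall v, nu (tau v) = tau (nu v).
Hypothesis nurho : forall v, nu (rho v) = rho (nu v).
Hypothesis rhoe0 : rho (e 0) = nu (e 0).
Hypothesis rhoeS : forall k, (k.+1 < m)%N -> rho (e k.+1) = e k.+1.

Local Notation H := hemisphere.
Local Notation P := prism.
Definition pred_prism k := if k is k'.+1 then P k' else [::].
Local Notation P' := pred_prism.

Lemma pure_map (g : V -> V) n (c : seq (seq V)) : pure n c -> pure n (map (map g) c).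
Proof. by move=> cn _ /mapP[t tc ->]; rewrite size_map cn. Qed.

Lemma pure_cone v n (c : seq (seq V)) : pure n c -> pure n.+1 (map (cons v) c).
Proof. by move=> cn _ /mapP[t tc ->]; rewrite /= cn. Qed.

Lemma pure_cat n (c c' : seq (seq V)) : pure n c -> pure n c' -> pure n (c ++ c').
Proof. by move=> cn cn' s; rewrite mem_cat => /orP[/cn|/cn']. Qed.

Lemma pureH k : pure k.+1 (H k).
Proof.
elim: k => [|k IH] /=; first by move=> s; rewrite inE => /eqP->.
by apply: pure_cone; apply: pure_cat => //; exact: pure_map.
Qed.

Lemma pureP k : pure k.+2 (P k).
Proof.
elim: k => [|k IH]; apply: pure_cone; (apply: pure_cat;
  first exact: pure_map (pureH (k := _))); apply: pure_cat.
- exact: (@pureH 0).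
- by [].
- exact: (@pureH k.+1).
- by apply: pure_cat => //; exact: pure_map.
Qed.

Lemma bd_map (g : V -> V) c : bd (map (map g) c) = map (map g) (bd c).
Proof.
rewrite /bd map_flatten -!map_comp; congr flatten; apply: eq_map => s /=.
exact: faces_map.
Qed.

Lemma xsum_nuK c f : xsum c (f \o (map nu \o map nu)) = xsum c f.
Proof. by apply: eq_xsum => s /=; rewrite -map_comp map_id_in// => v _; exact: nuK. Qed.

(** A hemisphere is a cone over the sphere [H k + nu (H k)]. This sphere is a cycle: its boundary is
    the next lower sphere plus the antipode of that sphere, which is the same chain. *)
Lemma bdH k : chain_eq (bd (H k.+1)) (H k ++ map (map nu) (H k)).
Proof.
have cyc j : xsum (bd (H j ++ map (map nu) (H j))) =1 fun=> false.
  elim: j => [|j IH] f; first by rewrite /= /bd /= !xsum_cons xsum_nil /= addbF addbb.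
  rewrite bd_cat bd_map xsum_cat xsum_map.
  rewrite /= !bd_cone !xsum_cat !xsum_map !IH !addbF /= .
  rewrite xsum_nuK addbC; rewrite [X in _ (+) X]addbC.
  by rewrite addbC addbb.
move=> f; rewrite /= bd_cone !xsum_cat [X in _ (+) X]xsum_map cyc.
by rewrite addbF.
Qed.

(** [rho] exchanges the two points [e 0] and [nu (e 0)], fixes the later apices and commutes with
    [nu]. [H 0] itself is not invariant, which is why the index starts at 1. *)
Lemma rhoH k : (k.+1 < m)%N ->
  chain_eq (map (map rho) (H k.+1)) (H k.+1).
Proof.
elim: k => [|k IH] km f.
  by rewrite /= !xsum_cons !xsum_nil /= rhoeS// -nurho rhoe0 nuK !addbF addbC.
rewrite [in RHS]/= -/(H k.+1) xsum_map xsum_map /=.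
rewrite -[map (cons (e k.+1)) _]/(H k.+1).
rewrite xsum_map !xsum_cat.
have E g : xsum (H k.+1) (g \o map rho) = xsum (H k.+1) g.
  rewrite -xsum_map IH//; exact: ltnW.
rewrite -[in RHS]E [X in _ = _ (+) X]xsum_map -[in X in _ = _ (+) X]E xsum_map.
congr addb; apply: eq_xsum => s /=; rewrite rhoeS//.
by rewrite -!map_comp; congr (f (_ :: _)); apply: eq_map => v /=; rewrite nurho.
Qed.

Lemma prismE k :
  P k = map (cons (q k)) (map (map tau) (H k) ++ H k ++ P' k ++ map (map nu) (P' k)).
Proof. by case: k. Qed.

(** The prism is a cone over the right-hand side, so it suffices that the latter is a cycle. In its
    boundary the four copies of [H] at the two ends cancel against those in the boundary of the two
    side prisms, and the lower prisms cancel in pairs because [nu] is an involution. *)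
Lemma bdP k : chain_eq (bd (P k))
  (map (map tau) (H k) ++ H k ++ P' k ++ map (map nu) (P' k)).
Proof.
have nuC c f : xsum c ((f \o map nu) \o map tau) = xsum c ((f \o map tau) \o map nu).
  apply: eq_xsum => s /=; rewrite -!map_comp.
  by congr f; apply: eq_map => v /=.
suff cyc : xsum (bd (map (map tau) (H k) ++ H k ++ P' k ++
    map (map nu) (P' k))) =1 fun=> false.
  by move=> f; rewrite prismE bd_cone xsum_cat [X in _ (+) X]xsum_map cyc addbF.
elim: k => [|k IH] f.
  by rewrite /= /bd /= !xsum_cons xsum_nil /= addbF addbb.
have bdP c : xsum (bd (P k)) c =
    xsum (map (map tau) (H k) ++ H k ++ P' k ++ map (map nu) (P' k)) c.
  by rewrite prismE bd_cone xsum_cat [X in _ (+) X]xsum_map IH addbF.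
rewrite [P' k.+1]/(P k) !bd_cat !xsum_cat !bd_map.
rewrite [xsum (map _ (bd (H _))) _]xsum_map [xsum (map _ (bd (P _))) _]xsum_map.
rewrite 2!bdH 2!bdP !xsum_cat !xsum_map nuC xsum_nuK.
by do 4 case: (xsum (H k) _); do 2 case: (xsum (P' k) _).
Qed.

Section Count.
Variables (r : nat) (lam : V -> nat) (small : seq V -> Prop).
Hypothesis smallH :
  forall k, (k < m)%N -> {in isubdiv r k.+1 (H k), forall s, small s}.
Hypothesis smallP :
  forall k, (k < m)%N -> {in isubdiv r k.+2 (P k), forall s, small s}.
Hypothesis small_rho : forall s, small s -> small (map rho s).
Hypothesis small_coherent : forall s, small s -> coherent (map lam s).
Hypothesis lam_nu :
  forall s, small s -> {in s, forall v, lam (nu v) = flip (lam v)}.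
Hypothesis lam_tau :
  forall s, small s -> {in s, forall v, lam (tau v) = flip (lam (rho v))}.
Hypothesis lam_lt : forall s, small s -> {in s, forall v, lam v < m.*2}%N.

Local Notation A b c := (xsum c (alternates b \o map lam)).
Local Notation "H^r k" := (isubdiv r k.+1 (H k)) (at level 10, k at level 9).
Local Notation "P^r k" := (isubdiv r k.+2 (P k)) (at level 10, k at level 9).

Lemma alternates_bd n c : pure n.+1 c ->
  A true (bd c) = A true c (+) A false c.
Proof.
move=> cn; rewrite xsum_bd -xsumD; apply: eq_xsum_in => s /cn sn /=.
by rewrite -xsum_map -faces_map alternates_faces ?size_map ?sn.
Qed.

Lemma alternates_nu b c : {in c, forall s, small s} ->
  A b (map (map nu) c) = A (~~ b) c.
Proof.
move=> cs; rewrite xsum_map; apply: eq_xsum_in => s /cs ss /=.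
rewrite -alternates_flip; last exact: small_coherent.
rewrite -!map_comp; congr alternates.
by apply/eq_in_map => v vs /=; exact: lam_nu vs.
Qed.

Lemma alternates_tau b c : {in c, forall s, small s} ->
  A b (map (map tau) c) = A (~~ b) (map (map rho) c).
Proof.
move=> cs; rewrite !xsum_map; apply: eq_xsum_in => s /cs ss /=.
rewrite -alternates_flip; last by apply: small_coherent; exact: small_rho.
rewrite -!map_comp; congr alternates.
by apply/eq_in_map => v vs /=; exact: lam_tau vs.
Qed.

(** The alternating simplices of [H k], of either initial sign, are counted by those of one sign on
    its boundary. There [nu] exchanges the signs, which leaves the count for [H (k - 1)]; at the
    bottom is the empty simplex, which alternates. *)
Lemma hemisphere_odd k : (k < m)%N -> A true (H^r k) (+) A false (H^r k).
Proof.
elim: k => [|k IH] km.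
  rewrite -(alternates_bd (pure_isubdiv (pureH (k := 0)))).
  rewrite bd_isubdiv; last exact: pureH.
  suff -> : isubdiv r 0 (bd (H 0)) = [:: [::]] by rewrite xsum1.
  by elim: (r) => //= r' ->.
rewrite -(alternates_bd (pure_isubdiv (pureH (k := k.+1)))).
rewrite bd_isubdiv; last exact: pureH.
rewrite (isubdiv_eq _ _ (@bdH k)) isubdiv_cat isubdiv_map//; last exact: pureH.
rewrite xsum_cat alternates_nu; last by apply: smallH; exact: ltnW.
by apply: IH; exact: ltnW.
Qed.

(** The count moves to the boundary. The side prisms contribute the count for [k - 1]. By [lam_tau]
    the far end is counted as [rho (H k)] with the opposite sign: for [k > 0] this is [H k], and the
    two ends contribute the odd number of [hemisphere_odd]; for [k = 0] it is [nu (H 0)], and the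
    two ends cancel. *)
Lemma prism_parity k : (k < m)%N ->
  A true (P^r k) (+) A false (P^r k) = odd k.
Proof.
elim: k => [|k IH] km; rewrite -(alternates_bd (pure_isubdiv (pureP (k := _)))).
  rewrite bd_isubdiv; last exact: pureP.
  rewrite (isubdiv_eq _ _ (@bdP 0)) cats0 isubdiv_cat isubdiv_map//; last exact: pureH.
  rewrite xsum_cat alternates_tau; last exact: smallH.
  rewrite -isubdiv_map//; last exact: pureH.
  have -> : map (map rho) (H 0) = map (map nu) (H 0) by rewrite /= rhoe0.
  rewrite isubdiv_map//; last exact: pureH.
  by rewrite alternates_nu ?addbb//; exact: smallH.
rewrite bd_isubdiv; last exact: pureP.
rewrite (isubdiv_eq _ _ (@bdP k.+1)) !isubdiv_cat !isubdiv_map//; last 2 first.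
- exact: pureP.
- exact: pureH.
rewrite !xsum_cat alternates_tau; last exact: smallH.
rewrite -isubdiv_map//; last exact: pureH.
rewrite (isubdiv_eq _ _ (@rhoH k km)) alternates_nu; last first.
  by apply: smallP; exact: ltnW.
rewrite [pred_prism _]/= IH; last exact: ltnW.
by rewrite addbA [X in X (+) _]addbC hemisphere_odd.
Qed.

(** For even [m > 0] the dimension [m - 1] is odd, so some simplex of the prism alternates; but it
    has [m + 1] vertices and labels of only [m] indices. *)
Lemma even_dimension : ~~ odd m -> m = 0.
Proof.
have := prism_parity; case: m smallP lam_lt => // m' smallP' lam_lt' par om.
have := par m' (ltnSn _); move: om => /=; rewrite negbK => ->.
have P0 b : A b (P^r m') = false.
  rewrite -[RHS](@big1_seq _ false addb _ (isubdiv r m'.+2 (P m')) xpredT (fun=> false))//.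
  apply: eq_xsum_in => s sP /=; have ss := smallP' _ (ltnSn _) _ sP.
  apply: (@alternates_size _ _ m'.+1).
  - exact: small_coherent.
  - by rewrite all_map; apply/allP => v; exact: lam_lt'.
  - by rewrite size_map (pure_isubdiv (pureP (k := m')) sP).
by rewrite !P0.
Qed.

End Count.
End FanCount.

(** * Zeros of odd maps *)

Section Mesh.
Variables (R : realType) (V : normedModType R).
Implicit Types (s : seq V).

Definition diam_le (d : R) s := {in s &, forall x y, `|x - y| <= d}.

Lemma barycenterB s w : (0 < size s)%N ->
  barycenter s - w = (size s)%:R^-1 *: \sum_(v <- s) (v - w).
Proof.
move=> s0; rewrite big_split /= scalerDr; congr (_ + _).
rewrite big_const_seq count_predT iter_addr_0.
rewrite -[X in _ *: X]scaler_nat scalerA mulVf ?scale1r//.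
by rewrite pnatr_eq0 -lt0n.
Qed.

Lemma norm_barycenter s w (d : R) : (0 < size s)%N ->
  {in s, forall v, `|v - w| <= d} -> `|barycenter s - w| <= d.
Proof.
move=> s0 sd; have n0 : 0 < (size s)%:R :> R by rewrite ltr0n.
rewrite barycenterB// normrZ ger0_norm ?invr_ge0 ?ler0n//.
rewrite ler_pdivrMl//; apply: le_trans (ler_norm_sum _ _ _) _.
rewrite big_seq; apply: le_trans (ler_sum _ (fun v vs => sd v vs)) _.
rewrite -big_seq big_const_seq count_predT iter_addr_0.
by rewrite mulr_natl.
Qed.

(** The term of [w] itself vanishes, so [size s - 1] of the [size s] terms remain in the average. *)
Lemma norm_barycenter_vertex s w (d : R) : w \in s -> 0 <= d ->
  {in s, forall v, `|v - w| <= d} ->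
  `|barycenter s - w| <= (1 - (size s)%:R^-1) * d.
Proof.
move=> ws d0 sd; have s0 : (0 < size s)%N by case: (s) ws.
have n0 : 0 < (size s)%:R :> R by rewrite ltr0n.
rewrite barycenterB// normrZ ger0_norm ?invr_ge0 ?ler0n//.
rewrite ler_pdivrMl// mulrA mulrBr mulfV ?gt_eqF// mulr1.
apply: le_trans (ler_norm_sum _ _ _) _.
rewrite (perm_big _ (perm_to_rem ws)) big_cons /= subrr normr0 add0r.
rewrite big_seq; apply: le_trans (ler_sum _ _) _.
  by move=> v /mem_rem; exact: sd.
rewrite -big_seq big_const_seq count_predT iter_addr_0 size_rem//.
by rewrite -subn1 -[X in X <= _]mulr_natl natrB.
Qed.

(** Two vertices of a small simplex either both lie in the subdivision of a facet, or one is the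
    barycenter, which is near all vertices and hence near all their averages. The bound [M] gives
    one contraction factor for all dimensions. *)
Lemma subdiv1_mesh (M : nat) n s (d : R) : (n <= M)%N -> size s = n ->
  0 <= d -> diam_le d s ->
  {in subdiv1 n s, forall t, diam_le ((1 - M%:R^-1) * d) t}.
Proof.
elim: n s => [|n IH] s nM sn d0 sd t /=.
  by rewrite inE => /eqP-> x y.
case/mapP => u /flattenP[_ /mapP[w ws ->] uw] ->.
have sw : size w = n by move/size_faces: ws; rewrite sn => -[].
have du : diam_le ((1 - M%:R^-1) * d) u.
  apply: IH uw => //; first exact: ltnW.
  by move=> x y xw yw; apply: sd; exact: mem_faces ws _.
have bs v : v \in s -> `|v - barycenter s| <= (1 - M%:R^-1) * d.
  move=> vs; rewrite distrC; apply: le_trans (norm_barycenter_vertex vs d0 _) _.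
    by move=> x xs; exact: sd.
  rewrite ler_wpM2r// lerD2l lerN2 lef_pV2 ?posrE ?ltr0n ?sn//.
    by rewrite ler_nat.
  exact: leq_trans nM.
have M0 : 0 <= (1 - M%:R^-1) * d.
  rewrite mulr_ge0// subr_ge0 invf_le1 ?ler1n ?ltr0n; exact: leq_trans nM.
have bu v : v \in u -> `|v - barycenter s| <= (1 - M%:R^-1) * d.
  apply: (@subdiv1_ind _ _ (fun v => `|v - barycenter s| <= _) n w) => //.
    by move=> x x0 xb; exact: norm_barycenter.
  by move=> x xw; apply: bs; exact: mem_faces ws xw.
move=> x y; rewrite !inE => /orP[/eqP->|xu] /orP[/eqP->|yu].
- by rewrite subrr normr0.
- by rewrite distrC; exact: bu.
- exact: bu.
- exact: du.
Qed.

Lemma isubdiv_mesh (M : nat) r n c (d : R) : (n <= M)%N -> (0 < M)%N ->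
  0 <= d -> pure n c -> {in c, forall s, diam_le d s} ->
  {in isubdiv r n c, forall s, diam_le ((1 - M%:R^-1) ^+ r * d) s}.
Proof.
move=> nM M0 d0 cn cd; elim: r => [|r IH] /=; first by rewrite expr0 mul1r.
move=> t /flattenP[_ /mapP[w ws ->] tw]; rewrite exprS -mulrA.
apply: subdiv1_mesh tw => //.
- exact: pure_isubdiv ws.
- by rewrite mulr_ge0// exprn_ge0// subr_ge0 invf_le1 ?ler1n ?ltr0n.
- exact: IH.
Qed.

End Mesh.

(** * The prism over the boundary of a cross-polytope *)

Section Prism.
Variables (R : realType) (n : nat).
Local Notation V := 'rV[R]_n.+2.
Implicit Types (v : V) (i : 'I_n.+1).

(** Coordinate 0 of a vector is the time; the other [n + 1] are those of the space of the
    cross-polytope. *)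
Definition spatial v i : R := v 0 (lift ord0 i).

Definition rescale (w : 'I_n.+2 -> R) v : V := \row_j (w j * v 0 j).
Definition antipode v := rescale (fun j => if j == ord0 then 1 else -1) v.
Definition mirror v := rescale (fun j => if j == lift ord0 ord0 then -1 else 1) v.
Definition advance v : V := v + delta_mx 0 ord0.
Definition apex k : V := delta_mx 0 (lift ord0 (inord k)).
Definition midapex k : V := apex k + 2^-1 *: delta_mx 0 ord0.

Lemma rescale_barycenter w (s : seq V) :
  rescale w (barycenter s) = barycenter (map (rescale w) s).
Proof.
rewrite /barycenter size_map big_map; apply/rowP => j; rewrite !mxE !summxE.
by rewrite mulrCA mulr_sumr; congr (_ * _); apply: eq_bigr => v _; rewrite mxE.
Qed.

Lemma advance_barycenter (s : seq V) : (0 < size s)%N ->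
  advance (barycenter s) = barycenter (map advance s).
Proof.
move=> s0; rewrite /barycenter size_map big_map big_split /= scalerDr.
congr (_ + _); rewrite big_const_seq count_predT iter_addr_0.
rewrite -[X in _ *: X]scaler_nat scalerA.
by rewrite mulVf ?scale1r// pnatr_eq0 -lt0n.
Qed.

Lemma antipodeK : involutive antipode.
Proof. by move=> v; apply/rowP => j; rewrite !mxE; case: eqP => _; ring. Qed.

Lemma antipode_advance v : antipode (advance v) = advance (antipode v).
Proof.
apply/rowP => j; rewrite !mxE eqxx /=; case: eqP => _ /=; ring.
Qed.

Lemma antipode_mirror v : antipode (mirror v) = mirror (antipode v).
Proof. by apply/rowP => j; rewrite !mxE mulrCA. Qed.

Lemma mirror_apex0 : mirror (apex 0) = antipode (apex 0).
Proof.
have -> : apex 0 = delta_mx 0 (lift ord0 ord0).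
  by congr (delta_mx _ (lift _ _)); apply/val_inj; rewrite /= inordK.
by apply/rowP => j; rewrite !mxE; case: eqVneq => [->|]; rewrite ?eqxx ?andbF ?mulr0.
Qed.

Lemma mirror_apexS k : (k < n)%N -> mirror (apex k.+1) = apex k.+1.
Proof.
move=> kn; apply/rowP => j; rewrite !mxE; case: eqP => [->|_]; last by rewrite mul1r.
rewrite (_ : (lift ord0 ord0 == lift ord0 (inord k.+1) :> 'I_n.+2) = false) ?andbF ?mulr0//.
by rewrite (inj_eq lift_inj) -val_eqE /= inordK.
Qed.

(* The face of the product of an interval with the boundary of a cross-polytope
   that the sign vector eps cuts out. *)
Definition on_face (eps : 'I_n.+1 -> R) v :=
  [/\ 0 <= v 0 ord0 <= 1, forall j, `|v 0 j| <= 1 & \sum_i eps i * spatial v i = 1].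

(** One [eps] for all vertices keeps the simplex, and so its barycenters, on one face. Past [k] the
    coordinates vanish and [eps] may still be changed; [eps (inord k) = 1] admits [apex k] and
    [midapex k] as further vertices. *)
Definition supported k (s : seq V) := exists eps : 'I_n.+1 -> R,
  [/\ forall i, `|eps i| <= 1, {in s, forall v, on_face eps v},
   forall v, v \in s -> forall i, (k < i)%N -> spatial v i = 0 & eps (inord k) = 1].

(** A compact set that contains the product of the interval and the boundary of the cross-polytope,
    and on which the spatial part never vanishes. *)
Definition prism_surface : set V :=
  [set v : V | [/\ 0 <= v 0 ord0 <= 1, forall j, `|v 0 j| <= 1 &
               1 <= \sum_i `|spatial v i|]].

Lemma spatial_apex k i : (k <= n)%N -> spatial (apex k) i = (i == k :> nat)%:R.
Proof.
move=> kn; rewrite /spatial mxE eqxx /= (inj_eq lift_inj); congr (nat_of_bool _)%:R.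
by apply/eqP/eqP => [->|ik]; [rewrite inordK|apply/val_inj; rewrite /= inordK].
Qed.

Lemma spatial_scale w v i : spatial (rescale w v) i = w (lift ord0 i) * spatial v i.
Proof. by rewrite /spatial mxE. Qed.

Lemma spatial_antipode v i : spatial (antipode v) i = - spatial v i.
Proof. by rewrite spatial_scale mulN1r. Qed.

Lemma spatial_advance v i : spatial (advance v) i = spatial v i.
Proof. by rewrite /spatial !mxE andbF addr0. Qed.

Lemma spatial_midapex k i : (k <= n)%N -> spatial (midapex k) i = (i == k :> nat)%:R.
Proof. by move=> kn; rewrite -spatial_apex// /spatial !mxE andbF mulr0 addr0. Qed.

Lemma time_apex k : apex k 0 ord0 = 0.
Proof. by rewrite mxE. Qed.

Lemma time_midapex k : midapex k 0 ord0 = 2^-1.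
Proof. by rewrite !mxE eqxx /= mulr1 add0r. Qed.

Local Notation hemi := (hemisphere antipode apex).
Local Notation pri := (prism antipode advance apex midapex).

Lemma norm_coord v : 0 <= v 0 ord0 <= 1 -> (forall i, `|spatial v i| <= 1) ->
  forall j, `|v 0 j| <= 1.
Proof.
move=> /andP[t0 t1] v1 j; case: (unliftP ord0 j) => [i ->|->]; first exact: v1.
by rewrite ger0_norm.
Qed.

Lemma supported_cone k v s : (k <= n)%N ->
  0 <= v 0 ord0 <= 1 -> (forall i, spatial v i = (i == k :> nat)%:R) ->
  supported k s -> supported k (v :: s).
Proof.
move=> kn vt vk [eps [e1 es ek ekk]]; exists eps; split=> //.
- move=> w; rewrite inE => /orP[/eqP->|/es//]; split=> //.
    by apply: norm_coord => // i; rewrite vk; case: eqP; rewrite ?normr1 ?normr0.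
  rewrite (bigD1 (inord k))//= vk inordK ?ltnS// eqxx mulr1 ekk big1 ?addr0//.
  move=> i ik; rewrite vk (_ : _ == _ = false) ?mulr0//.
  by apply: contraNF ik => /eqP ik; apply/eqP/val_inj; rewrite /= inordK// -ik.
- move=> w; rewrite inE => /orP[/eqP-> i|/ek//]; rewrite vk.
  by rewrite ltn_neqAle eq_sym => /andP[/negbTE->].
Qed.

(** Coordinate [k.+1] vanishes on [s], so [eps] can be reset to 1 there. *)
Lemma supportedS k s : (k < n)%N -> supported k s -> supported k.+1 s.
Proof.
move=> kn [eps [e1 es ek ekk]].
pose eps' i := if i == inord k.+1 then 1 else eps i.
exists eps'; split=> //.
- by move=> i; rewrite /eps'; case: eqP; rewrite ?normr1.
- move=> v vs; have [vt v1 vs1] := es v vs; split => //; rewrite -vs1; apply: eq_bigr => i _.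
  rewrite /eps'; case: eqVneq => // ->.
  by rewrite (ek _ vs) ?mulr0// inordK.
- by move=> v vs i /ltnW; exact: ek.
- by rewrite /eps' eqxx.
Qed.

(* The condition eps (inord k) = 1 is lost under the antipode, but it is
   restored by the change of eps that adding the next apex requires. *)
Lemma supported_antipode k s : (k < n)%N ->
  supported k s -> supported k.+1 (map antipode s).
Proof.
move=> kn [eps [e1 es ek ekk]].
pose eps' i := if i == inord k.+1 then 1 else - eps i.
have tE v : antipode v 0 ord0 = v 0 ord0 by rewrite mxE eqxx mul1r.
exists eps'; split=> //.
- by move=> i; rewrite /eps'; case: eqP; rewrite ?normr1 ?normrN.
- move=> _ /mapP[v vs ->]; have [vt v1 vs1] := es v vs; split; rewrite ?tE//.
    apply: norm_coord; rewrite ?tE// => i.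
    by rewrite spatial_antipode normrN; exact: v1.
  rewrite -vs1; apply: eq_bigr => i _.
  rewrite spatial_antipode /eps'; case: eqVneq => [->|_]; last by rewrite mulrNN.
  by rewrite (ek _ vs) ?oppr0 ?mulr0// inordK.
- by move=> _ /mapP[v vs ->] i /ltnW ki; rewrite spatial_antipode (ek _ vs)// oppr0.
- by rewrite /eps' eqxx.
Qed.

Lemma supported_hemisphere k : (k <= n)%N -> {in hemi k, forall s,
  supported k s /\ {in s, forall v, v 0 ord0 = 0}}.
Proof.
have t0 j : 0 <= apex j 0 ord0 <= 1 by rewrite time_apex lexx ler01.
elim: k => [|k IH] kn s /=.
  rewrite inE => /eqP->; split; last first.
    by move=> v; rewrite inE => /eqP->; exact: time_apex.
  apply: supported_cone => //; first by move=> i; exact: spatial_apex.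
  by exists (fun=> 1); split => // i; rewrite normr1.
have IHk := IH (ltnW kn).
case/mapP => u; rewrite mem_cat => /orP[uh|/mapP[w wh ->]] ->.
  have [us ut] := IHk _ uh; split.
    apply: supported_cone => //; last exact: supportedS.
    by move=> i; exact: spatial_apex.
  by move=> v; rewrite inE => /orP[/eqP->|/ut//]; exact: time_apex.
have [us ut] := IHk _ wh; split.
  apply: supported_cone => //; last exact: supported_antipode.
  by move=> i; exact: spatial_apex.
move=> v; rewrite inE => /orP[/eqP->|/mapP[x xw ->]]; first exact: time_apex.
by rewrite mxE eqxx mul1r ut.
Qed.

Lemma supported_advance k s : {in s, forall v, v 0 ord0 = 0} ->
  supported k s -> supported k (map advance s).
Proof.
move=> st [eps [e1 es ek ekk]]; exists eps; split=> //.
- move=> _ /mapP[v vs ->]; have [vt v1 vs1] := es v vs.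
  have t01 : 0 <= advance v 0 ord0 <= 1 by rewrite !mxE eqxx st// add0r ler01 lexx.
  split=> //; first by apply: norm_coord => // i; rewrite spatial_advance; exact: v1.
  by rewrite -vs1; apply: eq_bigr => i _; rewrite spatial_advance.
- by move=> _ /mapP[v vs ->] i /(ek _ vs); rewrite spatial_advance.
Qed.

Lemma supported_prism k : (k <= n)%N -> {in pri k, forall s, supported k s}.
Proof.
have t0 j : 0 <= midapex j 0 ord0 <= 1.
  by rewrite time_midapex invr_ge0 ler0n invf_le1// ler1n.
elim: k => [|k IH] kn s; rewrite prismE => /mapP[u]; rewrite !mem_cat.
  case/or4P => // [/mapP[w wh ->]|uh] ->; apply: supported_cone => //;
    do ?[by move=> i; exact: spatial_midapex].
  - by have [us ut] := supported_hemisphere kn wh; exact: supported_advance.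
  - by have [us ut] := supported_hemisphere kn uh.
case/or4P => [/mapP[w wh ->]|uh|uh|/mapP[w wh ->]] ->; apply: supported_cone => //;
  do ?[by move=> i; exact: spatial_midapex].
- by have [us ut] := supported_hemisphere kn wh; exact: supported_advance.
- by have [us ut] := supported_hemisphere kn uh.
- by apply: supportedS => //; apply: IH uh; exact: ltnW.
- by apply: supported_antipode => //; apply: IH wh; exact: ltnW.
Qed.

Lemma on_face_barycenter eps (s : seq V) : (0 < size s)%N ->
  {in s, forall v, on_face eps v} -> on_face eps (barycenter s).
Proof.
move=> s0 sf; have n0 : 0 < (size s)%:R :> R by rewrite ltr0n.
have avg (f : V -> R) (a : R) : {in s, forall v, f v = a} ->
    (size s)%:R^-1 * (\sum_(v <- s) f v) = a.
  move=> fa; rewrite big_seq (eq_bigr (fun=> a)) => [|v /fa//].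
  rewrite -big_seq big_const_seq count_predT iter_addr_0 -[X in _ * X]mulr_natl.
  by rewrite mulKf// gt_eqF.
have avgle (f : V -> R) (a : R) : {in s, forall v, f v <= a} ->
    (size s)%:R^-1 * (\sum_(v <- s) f v) <= a.
  move=> fa; rewrite -[leRHS](avg (fun=> a))// ler_wpM2l ?invr_ge0 ?ler0n//.
  by rewrite big_seq [leRHS]big_seq; apply: ler_sum.
split.
- rewrite !mxE summxE mulr_ge0 ?invr_ge0 ?ler0n//=.
    by apply: avgle => v /sf[/andP[]].
  by rewrite big_seq; apply: sumr_ge0 => v /sf[/andP[]].
- move=> j; rewrite !mxE summxE normrM ger0_norm ?invr_ge0 ?ler0n//.
  apply: le_trans (_ : _ <= (size s)%:R^-1 * \sum_(v <- s) `|v 0 j|) _.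
    by rewrite ler_wpM2l ?invr_ge0 ?ler0n// ler_norm_sum.
  by apply: avgle => v /sf[].
- rewrite -[RHS](avg (fun v => \sum_i eps i * spatial v i)); last by move=> v /sf[].
  rewrite exchange_big mulr_sumr /=; apply: eq_bigr => i _.
  by rewrite /spatial !mxE summxE mulrCA mulr_sumr.
Qed.

(** Barycenters stay on the face that [eps] cuts out, and [eps] is bounded by 1, so the sum that
    equals 1 is at most the sum of the absolute values. *)
Lemma supported_subdiv k c m r : pure m c ->
  {in c, forall s, supported k s} ->
  {in isubdiv r m c, forall s, {in s, forall v, prism_surface v}}.
Proof.
move=> cm cs.
suff H : {in isubdiv r m c, forall s, exists eps : 'I_n.+1 -> R,
    (forall i, `|eps i| <= 1) /\ {in s, forall v, on_face eps v}}.
  move=> s /H[eps [e1 sf]] v /sf[t01 v1 veps]; split => //.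
  rewrite -veps; apply: ler_sum => i _; apply: le_trans (ler_norm _) _.
  by rewrite normrM ler_piMl.
apply: isubdiv_ind => // [s sm [eps [e1 es]] t ts|s /cs[eps [e1 es _ _]]].
  exists eps; split=> //; apply: subdiv1_ind ts => // u u0 uf.
  exact: on_face_barycenter.
by exists eps.
Qed.

End Prism.

Section ContinuousFun.
Variables (R : realType) (T : topologicalType).
Implicit Types f g h : T -> R.

Lemma continuous_funD f g :
  continuous f -> continuous g -> continuous (fun x => f x + g x).
Proof. by move=> cf cg x; exact: (continuousD (cf x) (cg x)). Qed.

Lemma continuous_funB f g :
  continuous f -> continuous g -> continuous (fun x => f x - g x).
Proof. by move=> cf cg x; exact: (continuousB (cf x) (cg x)). Qed.

Lemma continuous_funM f g :
  continuous f -> continuous g -> continuous (fun x => f x * g x).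
Proof. by move=> cf cg x; exact: (continuousM (cf x) (cg x)). Qed.

Lemma continuous_funZ a f : continuous f -> continuous (fun x => a * f x).
Proof. by apply: continuous_funM; exact: cst_continuous. Qed.

Lemma continuous_norm_fun f : continuous f -> continuous (fun x => `|f x|).
Proof.
move=> cf x; apply: (@continuous_comp _ _ _ f Num.norm); first exact: cf.
exact: norm_continuous.
Qed.

Lemma continuous_fun_sum (I : finType) (P : pred I) (f : I -> T -> R) :
  (forall i, continuous (f i)) -> continuous (fun x => \sum_(i | P i) f i x).
Proof.
by move=> fc; apply: continuous_big => [|i _]; [exact: add_continuous|exact: fc].
Qed.

End ContinuousFun.

(** * Labels and the zero of an odd map *)

Section OddZero.
Variables (R : realType) (n : nat).
Local Notation V := 'rV[R]_n.+2.
Implicit Types (v : V).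

Lemma compact_prism_surface : compact (@prism_surface R n).
Proof.
apply: bounded_closed_compact.
  exists 1; split => // M M1 v [_ v1 _]; rewrite /= /Num.norm /= mx_normrE.
  apply/bigmax_leP; split; first by rewrite (le_trans ler01)// ltW.
  by move=> [i j] _ /=; rewrite ord1 (le_trans (v1 j))// ltW.
have cc j : continuous (fun v : V => v 0 j) by exact: coord_continuous.
have cn j : continuous (fun v : V => `|v 0 j|).
  exact: continuous_norm_fun (cc j).
have -> : @prism_surface R n =
    [set v : V | 0 <= v 0 ord0] `&` [set v : V | v 0 ord0 <= 1] `&`
    \bigcap_(j in setT) [set v : V | `|v 0 j| <= 1] `&`
    [set v : V | 1 <= \sum_i `|spatial v i|].
  apply/seteqP; split => v.
    by move=> [/andP[t0 t1] v1 sv]; split=> //; split=> // j _; exact: v1.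
  by move=> [[[/= t0 t1] v1] sv]; split; rewrite ?t0 ?t1// => j; exact: v1.
have cle (f : V -> R) (a : R) : continuous f -> closed [set v | f v <= a].
  move=> /continuous_closedP cf; exact: (cf _ (@closed_le _ a)).
have cge (f : V -> R) (a : R) : continuous f -> closed [set v | a <= f v].
  move=> /continuous_closedP cf; exact: (cf _ (@closed_ge _ a)).
apply: closedI; last first.
  by apply: cge; apply: continuous_fun_sum => i; exact: cn.
apply: closedI; first by apply: closedI; [apply: cge|apply: cle]; exact: cc.
by apply: closed_bigI => j _; apply: cle; exact: cn.
Qed.

Lemma norm_rV_le v (d : R) : 0 <= d -> (forall j, `|v 0 j| <= d) -> `|v| <= d.
Proof.
move=> d0 vd; rewrite /Num.norm /= mx_normrE; apply/bigmax_leP; split=> //.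
by move=> [i j] _ /=; rewrite ord1.
Qed.

Lemma coord_le_norm v j : `|v 0 j| <= `|v|.
Proof.
rewrite [leRHS]/Num.norm /= mx_normrE; apply/bigmax_geP; right => /=.
by exists (0, j).
Qed.

Lemma norm_mirror v : `|mirror v| = `|v|.
Proof.
suff H (w : V) : `|mirror w| <= `|w|.
  apply/eqP; rewrite eq_le H /=; suff {1}-> : v = mirror (mirror v) by exact: H.
  by apply/rowP => j; rewrite !mxE; case: eqP => _; ring.
apply: norm_rV_le => // j; rewrite mxE normrM.
by case: eqP => _; rewrite ?normrN normr1 mul1r coord_le_norm.
Qed.

Section Label.
Variable F : V -> 'I_n.+1 -> R.

Definition dominant v : 'I_n.+1 := [arg max_(i > ord0) `|F v i|]%O.

Definition label v : nat := (dominant v).*2 + (F v (dominant v) < 0)%R.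

Lemma dominantP v i : `|F v i| <= `|F v (dominant v)|.
Proof. by rewrite /dominant; case: arg_maxP => // j _; exact. Qed.

Lemma label_half v : (label v)./2 = dominant v.
Proof. by rewrite /label addnC half_bit_double. Qed.

Lemma label_lt v : (label v < n.+1.*2)%N.
Proof. by rewrite -ltn_half_double label_half. Qed.

(** As [F v] is not zero, its dominant coordinate is not zero either, so its sign really changes. *)
Lemma label_flip v w : (forall i, F w i = - F v i) -> (exists i, F v i != 0) ->
  label w = flip (label v).
Proof.
move=> wv [i0 vi0].
have E : dominant w = dominant v.
  rewrite /dominant; congr (Order.arg_max _ _ _); apply/funext => i.
  by rewrite wv normrN.
apply: eq_half_odd; first by rewrite half_flip !label_half E.
rewrite odd_flip /label !oddD !odd_double /= E wv oppr_lt0 !oddb.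
have : F v (dominant v) != 0.
  by rewrite -normr_gt0 (lt_le_trans _ (dominantP v i0))// normr_gt0.
by case: ltgtP.
Qed.

(** Near [z] every coordinate moves by less than [M / 4], so dominant coordinates exceed [3 M / 4]
    in absolute value, while the values of one coordinate at two points differ by less than [M / 2]:
    their signs agree. *)
Lemma label_locally_coherent z : (exists i, F z i != 0) ->
  (forall i, {for z, continuous (F ^~ i)}) ->
  exists2 r, 0 < r & forall x y : V, ball z r x -> ball z r y ->
    (label x)./2 = (label y)./2 -> label x = label y.
Proof.
move=> [i0 zi0] cF; set M := `|F z (dominant z)|.
have M0 : 0 < M by rewrite (lt_le_trans _ (dominantP z i0))// normr_gt0.
have zF i : \forall x \near z, `|F z i - F x i| < M / 4.
  have /cvgrPdist_lt := cF i.
  by apply; rewrite divr_gt0.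
have := filter_forall (nbhs_filter z) zF.
case/nbhs_ballP => r /= r0 rP; exists r => // x y /rP Fx /rP Fy.
rewrite !label_half => /val_inj xy; rewrite /label -xy.
have := dominantP x (dominant z); have := dominantP y (dominant z).
rewrite -xy; move: (dominant x) => i e1 e2; congr (_ + nat_of_bool _)%N.
have := Fx i; have := Fy i; have := Fx (dominant z); have := Fy (dominant z).
rewrite !ltr_distl => /andP[a1 a2] /andP[b1 b2] /andP[c1 c2] /andP[d1 d2].
have [x0|x0] := ltP (F x i) 0; have [y0|y0] := ltP (F y i) 0 => //; exfalso.
- move: e1 e2; rewrite (ger0_norm y0) (ltr0_norm x0).
  move: M0 a1 a2 b1 b2 c1 c2 d1 d2; rewrite /M.
  have [z0|z0] := ger0P (F z (dominant z)); have [u0|u0] := ger0P (F x (dominant z));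
  have [w0|w0] := ger0P (F y (dominant z)); lra.
- move: e1 e2; rewrite (ger0_norm x0) (ltr0_norm y0).
  move: M0 a1 a2 b1 b2 c1 c2 d1 d2; rewrite /M.
  have [z0|z0] := ger0P (F z (dominant z)); have [u0|u0] := ger0P (F x (dominant z));
  have [w0|w0] := ger0P (F y (dominant z)); lra.
Qed.
End Label.

Lemma mirrorB (x y : V) : mirror x - mirror y = mirror (x - y).
Proof. by apply/rowP => j; rewrite !mxE mulrBr. Qed.

Lemma surface_spatial v : prism_surface v -> exists i, spatial v i != 0.
Proof.
case=> _ _ v1; apply/existsP; rewrite -[X in is_true X]negbK negb_exists.
apply/negP => /forallP v0; move: v1; rewrite big1 ?ler10// => i _.
by have := v0 i; rewrite negbK => /eqP->; rewrite normr0.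
Qed.

Lemma surface_mirror v : prism_surface v -> prism_surface (mirror v).
Proof.
move=> [t01 v1 sv].
have nE j : `|mirror v 0 j| = `|v 0 j|.
  by rewrite mxE normrM; case: eqP => _; rewrite ?normrN normr1 mul1r.
split; first by rewrite mxE mul1r.
- by move=> j; rewrite nE; exact: v1.
- by apply: le_trans sv _; apply: ler_sum => i _; rewrite /spatial nE.
Qed.

Lemma supported_diam k (s : seq V) : supported k s -> diam_le 2 s.
Proof.
move=> [eps [_ es _ _]] x y /es[_ x1 _] /es[_ y1 _].
apply: norm_rV_le => // j; rewrite !mxE.
by apply: le_trans (ler_normB _ _) _; rewrite (natrD _ 1 1) lerD.
Qed.

Theorem odd_map_zero (F : V -> 'I_n.+1 -> R) : odd n ->
  (forall v, (exists i, spatial v i != 0) ->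
    forall i, {for v, continuous (F ^~ i)}) ->
  (forall v i, F (antipode v) i = - F v i) ->
  (forall v i, F (advance v) i = - F (mirror v) i) ->
  exists2 v, exists i, spatial v i != 0 & forall i, F v i = 0.
Proof.
move=> oddn cF Fanti Fadv; apply: contrapT => F0.
have nzF v : prism_surface v -> exists i, F v i != 0.
  move=> /surface_spatial v0; apply: contrapT => Fv; apply: F0; exists v => // i.
  by apply/eqP; apply: contrapT => /negP Fvi; apply: Fv; exists i.
(* A Lebesgue number: by compactness local coherence holds at one scale [eta] on the whole
   surface. *)
have [eta eta0 coh] : exists2 eta : R, 0 < eta & forall x y : V,
    prism_surface x -> `|x - y| < eta ->
    (label F x)./2 = (label F y)./2 -> label F x = label F y.
  have /compact_near_coveringP := compact_prism_surface.
  move=> /(_ _ (0^'+ : set_system R) (fun eta x => forall y, `|x - y| < eta ->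
    (label F x)./2 = (label F y)./2 -> label F x = label F y)).
  have Ff : Filter (0^'+ : set_system R) by exact: _.
  move=> /(_ Ff) H; have {H} : \forall eta \near (0 : R)^'+, @prism_surface R n `<=`
      (fun x => forall y, `|x - y| < eta ->
      (label F x)./2 = (label F y)./2 -> label F x = label F y).
    apply: H => z zS.
    have [r r0 zr] := label_locally_coherent (nzF z zS) (cF z (surface_spatial zS)).
    exists (ball z (r / 2), [set eta | eta < r / 2]).
      split => /=; first by apply: nbhsx_ballx; rewrite divr_gt0.
      by apply: nbhs_right_lt; rewrite divr_gt0.
    move=> [x eta] [/= zx er] y xy; apply: zr.
      by apply: le_ball zx; rewrite ler_pdivrMr// ler_peMr ?ler1n// ltW.
    rewrite [r]splitr; apply: (ball_triangle zx).
    by rewrite -ball_normE /=; exact: lt_trans er.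
  move=> H; have : \forall eta \near (0 : R)^'+, 0 < eta /\ @prism_surface R n `<=`
      (fun x => forall y, `|x - y| < eta ->
      (label F x)./2 = (label F y)./2 -> label F x = label F y).
    by apply: filterI => //; exact: nbhs_right_gt.
  by case/(@filter_ex _ _ _) => eta [eta0 H1]; exists eta => // x y xS; exact: H1.
(* The contraction factor of one subdivision: simplices of the prisms have at most [n + 2] vertices.
   The 2 below bounds the diameters before subdivision. *)
pose theta : R := 1 - n.+2%:R^-1.
have [r rP] : exists r, theta ^+ r * 2 < eta.
  have th1 : `|theta| < 1.
    rewrite ger0_norm ?subr_ge0 ?invf_le1 ?ler1n ?ltr0n//.
    by rewrite gtrBl invr_gt0 ltr0n.
  have /cvgrPdist_lt /(_ (eta / 2)) := cvg_expr th1.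
  rewrite divr_gt0// => /(_ isT) /filter_ex[r rP]; exists r.
  rewrite -ltr_pdivlMr//; apply: le_lt_trans (ler_norm _) _.
  by move: rP; rewrite sub0r normrN.
pose small (s : seq V) :=
  {in s, forall v, prism_surface v} /\ diam_le (theta ^+ r * 2) s.
have smallI k m c : (m <= n.+2)%N -> pure m c -> {in c, forall s, supported k s} ->
    {in isubdiv r m c, forall s, small s}.
  move=> mn cm cs s sc; split; first exact: (supported_subdiv cm cs sc).
  apply: (isubdiv_mesh mn _ _ cm _ sc) => // t /cs; exact: supported_diam.
have := @even_dimension R V n.+1 (@antipode R n) (@mirror R n) (@advance R n)
  (@apex R n) (@midapex R n) _ _ _ _ _ _ _ _ r (label F) small.
(* As [n] is odd, [m = n + 1] is even, and the count would force it to be 0. *)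
move=> H; suff : n.+1 = 0%N by [].
apply: H.
- by move=> s _; exact: rescale_barycenter.
- by move=> s _; exact: rescale_barycenter.
- exact: advance_barycenter.
- exact: antipodeK.
- exact: antipode_advance.
- exact: antipode_mirror.
- exact: mirror_apex0.
- exact: mirror_apexS.
- move=> k kn; apply: (smallI k); [exact: leqW|exact: pureH|].
  by move=> s /(@supported_hemisphere R n k kn)[].
- by move=> k kn; apply: (smallI k); [|exact: pureP|exact: (@supported_prism R n k kn)].
- move=> s [sS sd]; split.
    by move=> _ /mapP[v vs ->]; apply: surface_mirror; exact: sS.
  move=> _ _ /mapP[x xs ->] /mapP[y ys ->].
  by rewrite mirrorB norm_mirror; exact: sd.
- move=> s [sS sd] _ _ /mapP[x xs ->] /mapP[y ys ->]; apply: coh; first exact: sS.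
  by apply: le_lt_trans rP; exact: sd.
- by move=> s [sS sd] v vs; apply: label_flip; [exact: Fanti|exact: nzF (sS _ vs)].
- move=> s [sS sd] v vs; apply: label_flip; first exact: Fadv.
  by apply: nzF; apply: surface_mirror; exact: sS.
- by move=> s _ v _; exact: label_lt.
- by rewrite /= oddn.
Qed.

End OddZero.

(** * Haar-null sets of the orthogonal group *)

(** The tail unions [E k] decrease to the empty set, so their measures tend to 0; yet [E k] contains
    [D k], of measure [c]. *)
Lemma measure0_finite_multiplicity d (T : measurableType d) (R : realType)
    (mu : {finite_measure set T -> \bar R}) (D : (set T)^nat) (c : \bar R) :
  (forall k, measurable (D k)) -> (forall k, mu (D k) = c) ->
  (forall x, exists K, forall k, (K <= k)%N -> ~ D k x) -> c = 0%E.
Proof.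
move=> mD Dc finD; pose E k := \bigcup_(j in [set j | (k <= j)%N]) D j.
have mE k : measurable (E k) by apply: bigcup_measurable.
have E0 : \bigcap_k E k = set0.
  apply/seteqP; split => // x Ex; have [K KD] := finD x.
  by have [j /= Kj /KD] := Ex K Logic.I; exact.
have cE : mu \o E @ \oo --> 0%E.
  rewrite -(measure0 mu) -E0; apply: nonincreasing_cvg_mu => //.
  - by rewrite -ge0_fin_numE// fin_num_measure.
  - exact: bigcap_measurable.
  - move=> k l kl; apply/subsetPset => x [j /= lj Dj]; exists j => //=.
    exact: leq_trans lj.
apply/eqP; rewrite eq_le -{2}(Dc 0%N) measure_ge0 andbT.
apply: (cvge_ge _ cE).
apply: nearW => k; rewrite -(Dc k) /= le_measure ?inE//.
by move=> x Dx; exists k => /=.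
Qed.

Lemma borel_open (T : ptopologicalType) (A : set T) :
  open A -> measurable (A : set (borel T)).
Proof. by move=> oA; exact: sub_sigma_algebra. Qed.

Lemma borel_closed (T : ptopologicalType) (A : set T) :
  closed A -> measurable (A : set (borel T)).
Proof.
by move=> cA; rewrite -[A]setCK; apply: measurableC; apply: borel_open;
  exact: closed_openC.
Qed.

Section Rotation.
Variables (R : realType) (n : nat).
Implicit Types (a b : 'I_n) (c s : R) (g : 'M[R]_n).

Lemma orth_val_continuous : continuous (val : orth_group R n -> 'M[R]_n).
Proof. exact: initial_continuous. Qed.

Lemma closed_eq0 (T : topologicalType) (f : T -> R) :
  continuous f -> closed [set x | f x = 0].
Proof. by move=> /continuous_closedP cf; exact: (cf _ (@closed_eq _ 0)). Qed.

Definition rotation a b c s : 'M[R]_n :=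
  \matrix_(i, j) if i == a then c * (j == a)%:R - s * (j == b)%:R
                 else if i == b then s * (j == a)%:R + c * (j == b)%:R
                 else (i == j)%:R.

Lemma rotation_mul a b c s g i j : (rotation a b c s *m g) i j =
  if i == a then c * g a j - s * g b j
  else if i == b then s * g a j + c * g b j else g i j.
Proof.
have pick k : \sum_l (l == k)%:R * g l j = g k j.
  rewrite (bigD1 k)//= eqxx mul1r big1 ?addr0// => l /negbTE->.
  by rewrite mul0r.
rewrite mxE; under eq_bigr do rewrite mxE.
case: eqVneq => _; last case: eqVneq => _; last first.
- by rewrite -[RHS]pick; apply: eq_bigr => l _; rewrite eq_sym.
- rewrite -(pick a) -(pick b) !mulr_sumr -big_split; apply: eq_bigr => l _ /=.
  by rewrite mulrDl !mulrA.
- rewrite -(pick a) -(pick b) !mulr_sumr -sumrB; apply: eq_bigr => l _ /=.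
  by rewrite mulrBl !mulrA.
Qed.

Lemma rotation_orth a b c s : a != b -> c ^+ 2 + s ^+ 2 = 1 ->
  rotation a b c s *m (rotation a b c s)^T = 1%:M.
Proof.
move=> ab cs; have ba : (b == a) = false by rewrite eq_sym (negbTE ab).
apply/matrixP => i j; rewrite rotation_mul !mxE !eqxx ba (negbTE ab).
by case: (eqVneq i a) => [ia|ia]; [|case: (eqVneq i b) => [ib|ib]];
  case: (eqVneq j a) => [ja|ja]; case: (eqVneq j b) => [jb|jb];
  rewrite ?ia ?ib ?ja ?jb ?eqxx ?(negbTE ab) ?ba ?[a == j]eq_sym ?[b == j]eq_sym
    ?[j == i]eq_sym ?(negbTE ja) ?(negbTE jb) ?[i == a]eq_sym ?[i == b]eq_sym
    ?[a == i]eq_sym ?[b == i]eq_sym ?(negbTE ia) ?(negbTE ib) //=;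
  first [ring | rewrite -[RHS]cs; ring].
Qed.

Lemma rotation1 a b : rotation a b 1 0 = 1%:M.
Proof.
apply/matrixP => i j; rewrite !mxE; case: eqVneq => [->|_].
  by rewrite mul1r mul0r subr0 eq_sym.
by case: eqVneq => [->|//]; rewrite mul1r mul0r add0r eq_sym.
Qed.

(** The rational parametrisation of the circle by the tangent of the half-angle, which turns a
    trigonometric equation into a quadratic one in [t]. *)
Definition circle_cos (t : R) := (1 - t ^+ 2) / (1 + t ^+ 2).
Definition circle_sin (t : R) := (2 * t) / (1 + t ^+ 2).

Lemma circle_gt0 (t : R) : 0 < 1 + t ^+ 2.
Proof. by rewrite ltr_pwDl// sqr_ge0. Qed.

Lemma circleP (t : R) : circle_cos t ^+ 2 + circle_sin t ^+ 2 = 1.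
Proof. by rewrite /circle_cos /circle_sin; field; rewrite gt_eqF// circle_gt0. Qed.

Lemma circle_eq0 (t p q r : R) : p + circle_cos t * q + circle_sin t * r = 0 ->
  (p - q) * t ^+ 2 + (2 * r) * t + (p + q) = 0.
Proof.
move=> E; rewrite -[RHS](mulr0 (1 + t ^+ 2)) -E /circle_cos /circle_sin.
by field; rewrite gt_eqF// circle_gt0.
Qed.

Lemma quadratic_eq0 (p q r x y z : R) : x != y -> x != z -> y != z ->
  p * x ^+ 2 + q * x + r = 0 -> p * y ^+ 2 + q * y + r = 0 ->
  p * z ^+ 2 + q * z + r = 0 -> [/\ p = 0, q = 0 & r = 0].
Proof.
rewrite -[x == y]subr_eq0 -[x == z]subr_eq0 -[y == z]subr_eq0 => xy xz yz X Y Z.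
have XY : p * (x + y) + q = 0.
  apply: (mulfI xy); rewrite mulr0 -[RHS](subrr 0) -{1}X -Y; ring.
have XZ : p * (x + z) + q = 0.
  apply: (mulfI xz); rewrite mulr0 -[RHS](subrr 0) -{1}X -Z; ring.
have p0 : p = 0.
  apply: (mulfI yz); rewrite mulr0 -[RHS](subrr 0) -{1}XY -XZ; ring.
have q0 : q = 0 by rewrite -XY p0 mul0r add0r.
by split=> //; rewrite -X p0 q0 !mul0r !add0r.
Qed.

Variables (haar : probability (borel (orth_group R n)) R) (haarP : is_haar haar).

(* The sets [f (r g) = 0], for infinitely many rotations r of one plane, all
   have the same measure, and a g that does not annihilate p, q and r lies in at
   most two of them. *)
Lemma ae_rotation a b (f p q r : 'M[R]_n -> R) : a != b ->
  continuous f -> continuous p -> continuous q -> continuous r ->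
  (forall c s g, c ^+ 2 + s ^+ 2 = 1 -> 
    f (rotation a b c s *m g) = p g + c * q g + s * r g) ->
  {ae haar, forall u, f (val u) = 0 ->
    [/\ p (val u) = 0, q (val u) = 0 & r (val u) = 0]}.
Proof.
move=> ab cf cp cq cr fE.
have closed0 (h : 'M[R]_n -> R) : continuous h ->
    measurable ([set u | h (val u) = 0] : set (borel (orth_group R n))).
  move=> ch; apply: borel_closed.
  apply: (@closed_eq0 _ (fun u : orth_group R n => h (val u))) => u.
  by apply: continuous_comp; [exact: orth_val_continuous|exact: ch].
pose t k : R := k%:R.
pose rk k := mkorth (rotation_orth ab (circleP (t k))).
pose E : set (borel (orth_group R n)) := [set u | f (val u) = 0].
pose Z : set (borel (orth_group R n)) :=
  [set u | p (val u) = 0] `&` [set u | q (val u) = 0] `&` [set u | r (val u) = 0].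
pose D k : set (borel (orth_group R n)) := (orth_mul (rk k) @^-1` E) `\` Z.
have fk k u : f (val (orth_mul (rk k) u)) =
    p (val u) + circle_cos (t k) * q (val u) + circle_sin (t k) * r (val u).
  by rewrite /= fE// circleP.
have mE : measurable E by exact: closed0.
have mZ : measurable Z by apply: measurableI; [apply: measurableI|]; exact: closed0.
have EkE k : orth_mul (rk k) @^-1` E = [set u | p (val u) +
    circle_cos (t k) * q (val u) + circle_sin (t k) * r (val u) = 0].
  by apply/seteqP; split => u; rewrite /E /= fE// circleP.
have mEk k : measurable (orth_mul (rk k) @^-1` E : set (borel (orth_group R n))).
  rewrite EkE; apply: (closed0 (fun m => p m + circle_cos (t k) * q m +
    circle_sin (t k) * r m)).
  apply: continuous_funD; last exact: continuous_funZ.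
  by apply: continuous_funD => //; exact: continuous_funZ.
have ZE k : Z `<=` orth_mul (rk k) @^-1` E.
  by rewrite EkE => u [[/= -> ->] ->]; rewrite !mulr0 !addr0.
have mD k : measurable (D k) by exact: measurableD.
(* [Z] lies in every rotated copy of [E], and these copies have equal measure by invariance. *)
have Dc k : haar (D k) = (haar E - haar Z)%E.
  rewrite measureD//; last by rewrite -ge0_fin_numE// fin_num_measure.
  rewrite setIidr; last exact: ZE.
  by congr (_ - _)%E; exact: (haarP (rk k) mE).
have /(_ mD Dc) c0 := @measure0_finite_multiplicity _ _ _ haar D (haar E - haar Z)%E.
(* At [t = 0] the rotation is the identity, so [D 0] is the exceptional set [E] minus [Z]. *)
exists (D 0%N); split => //.
  rewrite Dc; apply: c0 => u; apply: contrapT => nK.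
  have inf K : exists2 k, (K <= k)%N & D k u.
    apply: contrapT => H; apply: nK; exists K => k Kk Dk.
    by apply: H; exists k.
  (* Three of the sets give three distinct roots of one quadratic polynomial, whose coefficients
     then vanish. *)
  have [k1 _ D1] := inf 0%N; have [k2 k12 D2] := inf k1.+1.
  have [k3 k23 D3] := inf k2.+1.
  have quad k : D k u -> (p (val u) - q (val u)) * t k ^+ 2 +
      (2 * r (val u)) * t k + (p (val u) + q (val u)) = 0.
    by rewrite /D EkE => -[/= + _]; exact: circle_eq0.
  have tneq k l : (k < l)%N -> t k != t l by move=> kl; rewrite eqr_nat ltn_eqF.
  have [pq r0 qp] := quadratic_eq0 (tneq _ _ k12) (tneq _ _ (ltn_trans k12 k23))
    (tneq _ _ k23) (quad _ D1) (quad _ D2) (quad _ D3).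
  case: D1 => _; apply; split; first split; rewrite /=; lra.
move=> u /= /not_implyP[fg0 pqr]; split.
  rewrite /E /= /circle_cos /circle_sin /t expr0n /= mulr0 mul0r subr0 addr0 divr1.
  by rewrite rotation1 mul1mx.
by move=> [[/= p0 q0] r0]; exact: pqr.
Qed.

End Rotation.

Section AlmostEverywhere.
Context d (T : measurableType d) (R : realType) (mu : {measure set T -> \bar R}).
Implicit Types P Q S : T -> Prop.

Lemma ae_imply P Q : (forall x, P x -> Q x) ->
  {ae mu, forall x, P x} -> {ae mu, forall x, Q x}.
Proof.
by move=> PQ; apply: negligibleS => x /= nQ /PQ.
Qed.

Lemma ae_imply2 P Q S : (forall x, P x -> Q x -> S x) ->
  {ae mu, forall x, P x} -> {ae mu, forall x, Q x} -> {ae mu, forall x, S x}.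
Proof.
move=> PQS nP nQ; apply: negligibleS (negligibleU nP nQ) => x /= nS.
by apply: contrapT => /not_orP[/contrapT Px /contrapT Qx]; apply: nS; exact: PQS.
Qed.

End AlmostEverywhere.

(** * Pluecker coordinates of random frames *)

Section Pluecker.
Variables (R : realType) (d : nat).
Local Notation V := 'rV[R]_d.+2.
Implicit Types (x y : V) (g : 'M[R]_d.+2) (n : 'rV[R]_d).

(** The coordinates that [append] creates: the last one is the 1 of [lift1], the one before it is
    the time axis of the space of world lines. *)
Definition hom_ix : 'I_d.+2 := ord_max.
Definition time_ix : 'I_d.+2 := lift ord_max ord_max.
Definition space_ix (i : 'I_d) : 'I_d.+2 := lift ord_max (lift ord_max i).

Definition pluecker (k l : 'I_d.+2) x y : R :=
  x 0 k * y 0 l - x 0 l * y 0 k.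

Definition pos_form n x y : R :=
  \sum_i n 0 i * pluecker time_ix (space_ix i) x y.
Definition vel_form n x y : R :=
  \sum_i n 0 i * pluecker (space_ix i) hom_ix x y.
Definition hom_form x y : R := pluecker time_ix hom_ix x y.

(* On the plane of the line {(p + t w, t)}, spanned by (w, 1, 0) and (p, 0, 1),
   this takes the value <n, a1 p + a2 w> - c. *)
Definition incidence (a1 a2 : R) n (c : R) x y : R :=
  a1 * pos_form n x y + a2 * vel_form n x y - c * hom_form x y.

(** The rows used are the first two columns of [g], which span the plane [grass2_orbit g] when [g]
    is orthogonal. *)
Definition on_frame (f : V -> V -> R) g : R :=
  f (row ord0 g^T) (row (lift ord0 ord0) g^T).

Lemma frame_plueckerE k l g : on_frame (pluecker k l) g =
  g k ord0 * g l (lift ord0 ord0) - g l ord0 * g k (lift ord0 ord0).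
Proof. by rewrite /on_frame /pluecker !mxE. Qed.

Lemma entry_continuous (i j : 'I_d.+2) : continuous (fun g => g i j).
Proof. exact: coord_continuous. Qed.

Lemma frame_pluecker_continuous k l : continuous (on_frame (pluecker k l)).
Proof.
rewrite (_ : on_frame _ = fun g => g k ord0 * g l (lift ord0 ord0) -
    g l ord0 * g k (lift ord0 ord0)); last first.
  by apply/funext => g; exact: frame_plueckerE.
by apply: continuous_funB; apply: continuous_funM; exact: entry_continuous.
Qed.

Lemma frame_pos_continuous n : continuous (on_frame (pos_form n)).
Proof.
apply: continuous_fun_sum => i; apply: continuous_funZ.
exact: frame_pluecker_continuous.
Qed.

Lemma frame_vel_continuous n : continuous (on_frame (vel_form n)).
Proof.
apply: continuous_fun_sum => i; apply: continuous_funZ.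
exact: frame_pluecker_continuous.
Qed.

Lemma frame_incidence_continuous a1 a2 n c :
  continuous (on_frame (incidence a1 a2 n c)).
Proof.
apply: continuous_funB.
  apply: continuous_funD; apply: continuous_funZ;
    by [exact: frame_pos_continuous|exact: frame_vel_continuous].
apply: continuous_funZ; exact: frame_pluecker_continuous.
Qed.

Lemma time_hom : (time_ix == hom_ix) = false.
Proof. by apply/negbTE; rewrite eq_sym neq_lift. Qed.

Lemma space_hom i : (space_ix i == hom_ix) = false.
Proof. by apply/negbTE; rewrite eq_sym neq_lift. Qed.

Lemma space_time i : (space_ix i == time_ix) = false.
Proof. by apply/negbTE; rewrite (inj_eq lift_inj) eq_sym neq_lift. Qed.

Lemma space_space i j : (space_ix i == space_ix j) = (i == j).
Proof. by rewrite !(inj_eq lift_inj). Qed.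

Definition ixE := (time_hom, space_hom, space_time, space_space,
  (eq_sym hom_ix time_ix, fun i => eq_sym hom_ix (space_ix i),
   fun i => eq_sym time_ix (space_ix i))).

Variables (haar : probability (borel (orth_group R d.+2)) R) (haarP : is_haar haar).

Lemma frame_pos_time_hom c s n g :
  on_frame (pos_form n) (rotation time_ix hom_ix c s *m g) =
  c * on_frame (pos_form n) g + s * on_frame (vel_form n) g.
Proof.
rewrite /on_frame /pos_form /vel_form !mulr_sumr -big_split.
apply: eq_bigr => i _ /=; rewrite -![pluecker _ _ _ _]/(on_frame (pluecker _ _) _).
by rewrite !frame_plueckerE !rotation_mul !ixE eqxx; ring.
Qed.

Lemma frame_vel_time_hom c s n g :
  on_frame (vel_form n) (rotation time_ix hom_ix c s *m g) =
  c * on_frame (vel_form n) g - s * on_frame (pos_form n) g.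
Proof.
rewrite /on_frame /pos_form /vel_form !mulr_sumr -sumrB.
apply: eq_bigr => i _ /=; rewrite -![pluecker _ _ _ _]/(on_frame (pluecker _ _) _).
by rewrite !frame_plueckerE !rotation_mul !ixE eqxx; ring.
Qed.

Lemma frame_hom_time_hom c s g : c ^+ 2 + s ^+ 2 = 1 ->
  on_frame hom_form (rotation time_ix hom_ix c s *m g) = on_frame hom_form g.
Proof.
move=> cs; rewrite !frame_plueckerE !rotation_mul !ixE !eqxx.
by rewrite -[RHS]mul1r -cs; ring.
Qed.

(** Three applications of [ae_rotation] lead from the vanishing of [incidence] to that of
    [hom_form], which excludes the planes of world lines. *)
Lemma ae_incidence a1 a2 n c : (n != 0) || (c != 0) -> (a1 != 0) || (a2 != 0) ->
  {ae haar, forall u, on_frame (incidence a1 a2 n c) (val u) = 0 ->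
    on_frame hom_form (val u) = 0}.
Proof.
move=> nc0 a0.
have cpos : continuous (on_frame (pos_form n)) by exact: frame_pos_continuous.
have cvel : continuous (on_frame (vel_form n)) by exact: frame_vel_continuous.
(* Turning time towards the last coordinate fixes [hom_form] and rotates [pos_form] and [vel_form]
   into each other; the two resulting equations have determinant [a1 ^+ 2 + a2 ^+ 2], which is not
   0. *)
have step1 : {ae haar, forall u, on_frame (incidence a1 a2 n c) (val u) = 0 ->
   c * on_frame hom_form (val u) = 0 /\ on_frame (pos_form n) (val u) = 0}.
  have := @ae_rotation R _ haar haarP time_ix hom_ix
    (on_frame (incidence a1 a2 n c)) (fun g => - c * on_frame hom_form g)
    (fun g => a1 * on_frame (pos_form n) g + a2 * on_frame (vel_form n) g)
    (fun g => a1 * on_frame (vel_form n) g - a2 * on_frame (pos_form n) g).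
  rewrite time_hom => /(_ isT (@frame_incidence_continuous a1 a2 n c)).
  have c1 : continuous (fun g => - c * on_frame hom_form g).
    by apply: continuous_funZ; exact: frame_pluecker_continuous.
  have c2 : continuous (fun g => a1 * on_frame (pos_form n) g + a2 * on_frame (vel_form n) g).
    by apply: continuous_funD; exact: continuous_funZ.
  have c3 : continuous (fun g => a1 * on_frame (vel_form n) g - a2 * on_frame (pos_form n) g).
    by apply: continuous_funB; exact: continuous_funZ.
  move=> /(_ c1 c2 c3) H; apply: ae_imply (H _) => [u|c' s' g cs].
    move=> + u0 => /(_ u0)[h0 pv vp]; split; first by rewrite -[RHS]oppr0 -h0 mulNr opprK.
    have : (a1 ^+ 2 + a2 ^+ 2) * on_frame (pos_form n) (val u) = 0.
      rewrite -[RHS](mulr0 a1) -pv -[RHS]subr0 -[X in _ = _ - X](mulr0 a2) -vp.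
      by ring.
    move=> /eqP; rewrite mulf_eq0 paddr_eq0 ?sqr_ge0// !sqrf_eq0.
    by move: a0; rewrite -negb_and => /negbTE-> /eqP.
  have -> h : on_frame (incidence a1 a2 n c) h = a1 * on_frame (pos_form n) h +
      a2 * on_frame (vel_form n) h - c * on_frame hom_form h by [].
  by rewrite frame_pos_time_hom frame_vel_time_hom frame_hom_time_hom//; ring.
have [c0|c0] := eqVneq c 0; last first.
  apply: ae_imply step1 => u H /H[/eqP + _].
  by rewrite mulf_eq0 (negbTE c0) => /eqP.
have {nc0}[i ni] : exists i, n 0 i != 0.
  move: nc0; rewrite c0 eqxx orbF => /eqP n0; apply: contrapT => H; apply: n0.
  apply/rowP => i; rewrite mxE; apply/eqP; apply: contrapT => /negP ni.
  by apply: H; exists i.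
(* Turning time towards [space_ix i] fixes the [i]-th term of [pos_form], which is therefore the
   constant part in the angle. *)
have step2 : {ae haar, forall u, on_frame (pos_form n) (val u) = 0 ->
   on_frame (pluecker time_ix (space_ix i)) (val u) = 0}.
  have := @ae_rotation R _ haar haarP time_ix (space_ix i)
    (on_frame (pos_form n)) (fun g => n 0 i * on_frame (pluecker time_ix (space_ix i)) g)
    (fun g => \sum_(j | j != i) n 0 j * on_frame (pluecker time_ix (space_ix j)) g)
    (fun g => - 1 * \sum_(j | j != i) n 0 j * on_frame (pluecker (space_ix i) (space_ix j)) g).
  rewrite !ixE => /(_ isT cpos).
  have c1 : continuous (fun g => n 0 i * on_frame (pluecker time_ix (space_ix i)) g).
    by apply: continuous_funZ; exact: frame_pluecker_continuous.
  have cs (h : 'I_d -> 'M[R]_d.+2 -> R) : (forall j, continuous (h j)) ->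
      continuous (fun g => \sum_(j | j != i) n 0 j * h j g).
    by move=> ch; apply: continuous_fun_sum => j; exact: continuous_funZ.
  move=> /(_ c1 (cs _ _)) H; apply: ae_imply (H _ _ _) => [u + u0| | |].
  - by case/(_ u0) => /eqP + _ _; rewrite mulf_eq0 (negbTE ni) => /eqP.
  - by move=> j; exact: frame_pluecker_continuous.
  - apply: continuous_funZ; apply: cs => j; exact: frame_pluecker_continuous.
  - move=> c' s' g c's'; rewrite [LHS](bigD1 i)//= -addrA; congr (_ + _).
      congr (_ * _); rewrite -[LHS]/(on_frame (pluecker _ _) _).
      rewrite !frame_plueckerE !rotation_mul !ixE !eqxx.
      by rewrite -[RHS]mul1r -c's'; ring.
    rewrite mulN1r mulrN !mulr_sumr -sumrB; apply: eq_bigr => j ji.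
    rewrite -[pluecker _ _ _ _]/(on_frame (pluecker _ _) _).
    by rewrite !frame_plueckerE !rotation_mul !ixE !eqxx (negbTE ji); ring.
(* Turning [space_ix i] towards the last coordinate mixes this Pluecker coordinate with
   [hom_form]. *)
have step3 : {ae haar, forall u, on_frame (pluecker time_ix (space_ix i)) (val u) = 0 ->
   on_frame hom_form (val u) = 0}.
  have := @ae_rotation R _ haar haarP (space_ix i) hom_ix
    (on_frame (pluecker time_ix (space_ix i))) (fun=> 0)
    (on_frame (pluecker time_ix (space_ix i))) (fun g => - 1 * on_frame hom_form g).
  rewrite !ixE => /(_ isT (@frame_pluecker_continuous _ _) (@cst_continuous _ _ _)).
  move=> /(_ (@frame_pluecker_continuous _ _)) H; apply: ae_imply (H _ _) => [u + u0| |].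
  - by case/(_ u0) => _ _ /eqP; rewrite mulN1r oppr_eq0 => /eqP.
  - by apply: continuous_funZ; exact: frame_pluecker_continuous.
  - move=> c' s' g c's'; rewrite !frame_plueckerE !rotation_mul !ixE !eqxx; ring.
have step12 : {ae haar, forall u, on_frame (incidence a1 a2 n c) (val u) = 0 ->
    on_frame (pluecker time_ix (space_ix i)) (val u) = 0}.
  by apply: ae_imply2 step1 step2 => u H1 H2 /H1[_ /H2].
by apply: ae_imply2 step12 step3 => u H1 H2 /H1 /H2.
Qed.

End Pluecker.

(** * Half-spaces of lines *)

Section Planes.
Variables (R : realType) (d : nat).
Local Notation V := 'rV[R]_d.+2.
Implicit Types (x y : V) (Phi : V -> V -> R).

Lemma span2P (x y v : V) :
  v \in <<[:: x; y]>>%VS <-> exists a b, v = a *: x + b *: y.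
Proof.
rewrite span_cons span_seq1; split.
  by case/memv_addP => _ /vlineP[a ->] [_ /vlineP[b ->] ->]; exists a, b.
by move=> [a [b ->]]; apply: memv_add; apply: memvZ; exact: memv_line.
Qed.

(* Such a Phi depends, up to a positive factor, on the plane spanned by x and y
   only, so that its sign is a function of the plane. *)
Definition det2_homogeneous Phi := forall x y a b a' b',
  Phi (a *: x + b *: y) (a' *: x + b' *: y) = (a * b' - b * a') ^+ 2 * Phi x y.

Definition plane_pos Phi (U : {vspace V}) : Prop :=
  exists x y, [/\ x \in U, y \in U & 0 < Phi x y].

Lemma plane_pos_span Phi x y : det2_homogeneous Phi ->
  plane_pos Phi <<[:: x; y]>> <-> 0 < Phi x y.
Proof.
move=> hPhi; split=> [[x' [y' [/span2P[a [b ->]] /span2P[a' [b' ->]]]]]|Phi0].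
  rewrite hPhi => P0; rewrite ltNge; apply/negP => P1; move: P0.
  by rewrite ltNge mulr_ge0_le0// sqr_ge0.
exists x, y; split=> //; apply/span2P.
  by exists 1, 0; rewrite scale1r scale0r addr0.
by exists 0, 1; rewrite scale1r scale0r add0r.
Qed.

Lemma pluecker_comb k l x y a b a' b' :
  pluecker k l (a *: x + b *: y) (a' *: x + b' *: y) =
  (a * b' - b * a') * pluecker k l x y.
Proof. by rewrite /pluecker !mxE; ring. Qed.

Lemma incidence_comb a1 a2 n c x y a b a' b' :
  incidence a1 a2 n c (a *: x + b *: y) (a' *: x + b' *: y) =
  (a * b' - b * a') * incidence a1 a2 n c x y.
Proof.
rewrite /incidence /pos_form /vel_form /hom_form pluecker_comb.
rewrite (eq_bigr (fun i => (a * b' - b * a') * (n 0 i * pluecker (time_ix d) (space_ix i) x y))).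
  rewrite [X in _ + _ * X](eq_bigr (fun i => (a * b' - b * a') *
    (n 0 i * pluecker (space_ix i) (hom_ix d) x y))).
    by rewrite -!mulr_sumr; ring.
  by move=> i _; rewrite pluecker_comb mulrCA.
by move=> i _; rewrite pluecker_comb mulrCA.
Qed.

Lemma val_grass2_orbit (g : orth_group R d.+2) :
  val (grass2_orbit g) = <<[:: row ord0 (val g)^T; row (lift ord0 ord0) (val g)^T]>>%VS.
Proof. by rewrite /= limg_span /= !lfunE /= -!rowE. Qed.

Lemma val_line_plane (l : line R d) : val (line_plane l) = lin_span (lift1 (val l)).
Proof. by []. Qed.

Definition vel_row (w : 'rV[R]_d) : V := append (append w 1) 0.
Definition pos_row (p : 'rV[R]_d) : V := append (append p 0) 1.

Lemma line_plane_worldline (p w : 'rV[R]_d) :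
  val (line_plane (worldline p w)) = <<[:: vel_row w; pos_row p]>>%VS.
Proof.
rewrite val_line_plane /= -lin_span_line; congr (lin_span (lift1 _)).
congr image; apply/funext => t.
by rewrite -append_linear add0r mulr1.
Qed.

Lemma append_hom (x : 'rV[R]_d.+1) t : append x t 0 (hom_ix d) = t.
Proof. exact: append_max. Qed.
Lemma append_time (x : 'rV[R]_d) s t : append (append x s) t 0 (time_ix d) = s.
Proof. by rewrite append_lift append_max. Qed.
Lemma append_space (x : 'rV[R]_d) s t i : append (append x s) t 0 (space_ix i) = x 0 i.
Proof. by rewrite !append_lift. Qed.
Definition appendE := (append_hom, append_time, append_space).

Lemma hom_worldline (p w : 'rV[R]_d) : hom_form (vel_row w) (pos_row p) = 1.
Proof. by rewrite /hom_form /pluecker !appendE; ring. Qed.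

Lemma pos_worldline n (p w : 'rV[R]_d) : pos_form n (vel_row w) (pos_row p) = dot p n.
Proof.
by apply: eq_bigr => i _; rewrite /pluecker !appendE; ring.
Qed.

Lemma vel_worldline n (p w : 'rV[R]_d) : vel_form n (vel_row w) (pos_row p) = dot w n.
Proof.
by apply: eq_bigr => i _; rewrite /pluecker !appendE; ring.
Qed.

Lemma incidence_worldline a1 a2 n c p w :
  incidence a1 a2 n c (vel_row w) (pos_row p) = a1 * dot p n + a2 * dot w n - c.
Proof.
by rewrite /incidence pos_worldline vel_worldline hom_worldline mulr1.
Qed.

Lemma row_ext x y : (forall i, x 0 (space_ix i) = y 0 (space_ix i)) ->
  x 0 (time_ix d) = y 0 (time_ix d) -> x 0 (hom_ix d) = y 0 (hom_ix d) -> x = y.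
Proof.
move=> s t h; apply/rowP => j; case: (unliftP ord_max j) => [k ->|->]; last exact: h.
by case: (unliftP ord_max k) => [i ->|->]; [exact: s|exact: t].
Qed.

(** A non-zero [hom_form] means that the direction [u] of the line has a non-zero time component.
    Dividing by it gives the velocity, and moving back to time 0 the position. *)
Lemma plane_worldline (l : line R d) x y : x \in val (line_plane l) ->
  y \in val (line_plane l) -> hom_form x y != 0 -> exists p w, l = worldline p w.
Proof.
rewrite val_line_plane; case: (lineP l) => x0 [u [u0 lE]].
rewrite lE lin_span_line => /span2P[a [b ->]] /span2P[a' [b' ->]].
rewrite /hom_form pluecker_comb mulf_eq0 negb_or => /andP[_].
rewrite /pluecker !append_hom mulr1 mul0r subr0 append_lift => ut.
pose w : 'rV[R]_d := \row_i (u 0 (lift ord_max i) / u 0 ord_max).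
pose p : 'rV[R]_d := \row_i (x0 0 (lift ord_max i) -
  x0 0 ord_max * (u 0 (lift ord_max i) / u 0 ord_max)).
exists p, w; apply/val_inj; rewrite lE /=.
have lineE s : x0 + s *: u = append (p + (x0 0 ord_max + s * u 0 ord_max) *: w)
    (x0 0 ord_max + s * u 0 ord_max).
  apply/rowP => j; case: (unliftP ord_max j) => [i ->|->].
    by rewrite append_lift !mxE; field.
  by rewrite append_max !mxE.
apply/seteqP; split => [_ [s _ <-]|_ [t _ <-]].
  by rewrite lineE; exists (x0 0 ord_max + s * u 0 ord_max).
exists ((t - x0 0 ord_max) / u 0 ord_max) => //; rewrite lineE.
by have -> : x0 0 ord_max + (t - x0 0 ord_max) / u 0 ord_max * u 0 ord_max = t
  by field.
Qed.

Definition lines_pos Phi : set (line R d) := [set l | plane_pos Phi (val (line_plane l))].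

Lemma orth_frame_continuous (f : 'M[R]_d.+2 -> R) : continuous f ->
  continuous (fun u : orth_group R d.+2 => f (val u)).
Proof.
by move=> cf u; apply: continuous_comp; [exact: orth_val_continuous|exact: cf].
Qed.

Lemma open_gt0 (T : topologicalType) (f : T -> R) :
  continuous f -> open [set x | 0 < f x].
Proof. by move=> /continuousP cf; exact: (cf _ (@open_gt _ 0)). Qed.

(** The set is open: openness in the Grassmannian is tested on frames, where the condition is
    [0 < on_frame Phi]. *)
Lemma measurable_lines_pos Phi : det2_homogeneous Phi -> continuous (on_frame Phi) ->
  measurable (lines_pos Phi : set (borel (line R d))).
Proof.
move=> hPhi cPhi; apply: borel_open.
exists [set U : grass2 R d | plane_pos Phi (val U)] => //.
rewrite /open /= /grass2_open /=.
rewrite (_ : _ @^-1` _ = [set u : orth_group R d.+2 | 0 < on_frame Phi (val u)]).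
  by apply: open_gt0; exact: orth_frame_continuous.
apply/funext => u; apply/propext.
rewrite -[X in X <-> _]/(plane_pos Phi (val (grass2_orbit u))) val_grass2_orbit.
exact: plane_pos_span.
Qed.

Lemma lines_pos_worldlines Phi : det2_homogeneous Phi ->
  (forall x y, 0 < Phi x y -> hom_form x y != 0) ->
  lines_pos Phi = [set worldline pw.1 pw.2 | pw in
    [set pw | 0 < Phi (vel_row pw.2) (pos_row pw.1)]].
Proof.
move=> hPhi Phih.
have wE p w : lines_pos Phi (worldline p w) <-> 0 < Phi (vel_row w) (pos_row p).
  rewrite -[X in X <-> _]/(plane_pos Phi (val (line_plane (worldline p w)))).
  by rewrite line_plane_worldline; exact: plane_pos_span.
apply/seteqP; split => [l lP|_ [[p w] /= Ppw <-]]; last exact/wE.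
have [x [y [xl yl xy]]] := lP.
have [p [w lE]] := plane_worldline xl yl (Phih _ _ xy).
by exists (p, w) => //=; apply/wE; rewrite -lE.
Qed.

End Planes.

(** * Measurability and stability of open half-spaces *)

Section HalfSpaces.
Variables (R : realType) (d : nat).
Local Notation V := 'rV[R]_d.+2.
Implicit Types (p w n : 'rV[R]_d) (c : R) (pw : 'rV[R]_d * 'rV[R]_d).

Definition worldlines (A : set ('rV[R]_d * 'rV[R]_d)) : set (borel (line R d)) :=
  [set worldline pw.1 pw.2 | pw in A].

Definition affine (a1 a2 : R) n c pw : R := a1 * dot pw.1 n + a2 * dot pw.2 n - c.

Definition half_pos (a1 a2 : R) n c := worldlines [set pw | 0 < affine a1 a2 n c pw].

Lemma worldline_inj p w p' w' : worldline p w = worldline p' w' -> (p, w) = (p', w').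
Proof.
move=> /(congr1 val) /= E.
have pt t : p + t *: w = p' + t *: w'.
  have : [set append (p + t *: w) t | t in setT] (append (p + t *: w) t) by exists t.
  rewrite E => -[t' _ /rowP e]; have := e ord_max; rewrite !append_max => tt.
  by apply/rowP => i; have := e (lift ord_max i); rewrite !append_lift tt.
have pp := pt 0; rewrite !scale0r !addr0 in pp; congr (_, _) => //.
by have := pt 1; rewrite pp !scale1r => /addrI.
Qed.

Lemma worldlinesE A p w : worldlines A (worldline p w) <-> A (p, w).
Proof.
split=> [[[p' w'] /= Apw /worldline_inj <-] //|Apw].
by exists (p, w).
Qed.

(** A change of basis multiplies both factors by its determinant. The factor [hom_form] makes the
    sign independent of the orientation and equals 1 on world lines. *)
Lemma incidence_hom_homogeneous a1 a2 n c :
  det2_homogeneous (fun x y => incidence a1 a2 n c x y * hom_form x y : R).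
Proof.
by move=> x y a b a' b'; rewrite incidence_comb /hom_form pluecker_comb; ring.
Qed.

Lemma measurable_worldlines_pos (Phi : V -> V -> R)
    (f : 'rV[R]_d * 'rV[R]_d -> R) :
  det2_homogeneous Phi -> continuous (on_frame Phi) ->
  (forall x y, 0 < Phi x y -> hom_form x y != 0) ->
  (forall pw, Phi (vel_row pw.2) (pos_row pw.1) = f pw) ->
  measurable (worldlines [set pw | 0 < f pw]).
Proof.
move=> hPhi cPhi Phih fE; rewrite /worldlines.
under eq_set do rewrite -fE.
by rewrite -lines_pos_worldlines//; exact: measurable_lines_pos.
Qed.

Lemma measurable_half_pos a1 a2 n c : measurable (half_pos a1 a2 n c).
Proof.
apply: (@measurable_worldlines_pos (fun x y => incidence a1 a2 n c x y * hom_form x y)).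
- exact: incidence_hom_homogeneous.
- apply: continuous_funM; first exact: frame_incidence_continuous.
  exact: frame_pluecker_continuous.
- by move=> x y; apply: contraTneq => ->; rewrite mulr0 ltxx.
- by move=> pw; rewrite incidence_worldline hom_worldline mulr1.
Qed.

Lemma measurable_worldlinesT : measurable (worldlines setT).
Proof.
rewrite (_ : setT = [set pw | 0 < (fun=> 1 : R) pw]); last first.
  by apply/esym/seteqP; split => // pw _ /=.
apply: (@measurable_worldlines_pos (fun x y => hom_form x y * hom_form x y)).
- by move=> x y a b a' b'; rewrite /hom_form pluecker_comb; ring.
- by apply: continuous_funM; exact: frame_pluecker_continuous.
- by move=> x y; apply: contraTneq => ->; rewrite mulr0 ltxx.
- by move=> pw; rewrite hom_worldline mulr1.
Qed.

(* The lower semicontinuity of the measure of a half-space rests on these sets: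
   they increase to the half-space, and a small change of the coefficients of
   the affine function keeps it positive there. *)
Definition margin pw : R := \sum_i (`|pw.1 0 i| + `|pw.2 0 i|) + 1.

Definition half_margin (a1 a2 : R) n c (e : R) :=
  worldlines [set pw | 0 < affine a1 a2 n c pw - e * margin pw].

(** [margin] in Pluecker coordinates. It scales by the absolute value of the determinant, so its
    product with [|hom_form|] scales by the square. *)
Definition frame_margin (x y : V) : R :=
  \sum_(i < d) (`|pluecker (time_ix d) (space_ix i) x y| +
    `|pluecker (space_ix i) (hom_ix d) x y|) + `|hom_form x y|.

Lemma measurable_half_margin a1 a2 n c e : measurable (half_margin a1 a2 n c e).
Proof.
apply: (@measurable_worldlines_pos (fun x y => incidence a1 a2 n c x y * hom_form x y
   - e * (`|hom_form x y| * frame_margin x y))).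
- move=> x y a b a' b'; rewrite incidence_comb /frame_margin /hom_form.
  set D := a * b' - b * a'.
  rewrite (eq_bigr (fun i : 'I_d => `|D| *
    (`|pluecker (time_ix d) (space_ix i) x y| + `|pluecker (space_ix i) (hom_ix d) x y|))).
    rewrite !pluecker_comb -/D !normrM -mulr_sumr -mulrDr.
    have DD : `|D| * `|D| = D ^+ 2 by rewrite -expr2 real_normK ?num_real.
    set S := _ + `|pluecker _ _ x y|; set J := incidence _ _ _ _ _ _.
    set h := pluecker _ _ _ _.
    transitivity (D ^+ 2 * (J * h) - e * ((`|D| * `|D|) * (`|h| * S))); first by ring.
    by rewrite DD; ring.
  by move=> i _; rewrite !pluecker_comb !normrM mulrDr.
- apply: continuous_funB.
    apply: continuous_funM; first exact: frame_incidence_continuous.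
    exact: frame_pluecker_continuous.
  apply: continuous_funZ; apply: continuous_funM.
    by apply: continuous_norm_fun; exact: frame_pluecker_continuous.
  apply: continuous_funD; last first.
    by apply: continuous_norm_fun; exact: frame_pluecker_continuous.
  apply: continuous_fun_sum => i; apply: continuous_funD;
    by apply: continuous_norm_fun; exact: frame_pluecker_continuous.
- by move=> x y; apply: contraTneq => ->; rewrite normr0 !(mulr0, mul0r) subrr ltxx.
- move=> [p w] /=; rewrite incidence_worldline /frame_margin hom_worldline.
  rewrite normr1 mulr1 mul1r; congr (_ - e * (_ + _)); apply: eq_bigr => i _.
  by rewrite /pluecker !appendE !(mulr0, mul0r, mulr1, mul1r) subr0 subr0.
Qed.

Lemma margin_gt0 pw : 0 < margin pw.
Proof. by rewrite ltr_wpDl// sumr_ge0// => i _; rewrite addr_ge0. Qed.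

(** The function is linear in [(p, w, 1)] with coefficients [a1 n], [a2 n] and [- c], and [margin]
    is the sum of the absolute values of these variables. *)
Lemma affine_perturb a1 a2 n c a1' a2' n' c' e pw :
  (forall i, `|a1' * n' 0 i - a1 * n 0 i| <= e) ->
  (forall i, `|a2' * n' 0 i - a2 * n 0 i| <= e) -> `|c' - c| <= e ->
  affine a1 a2 n c pw - e * margin pw <= affine a1' a2' n' c' pw.
Proof.
move=> h1 h2 h3.
have E b1 b2 m b : affine b1 b2 m b pw =
    \sum_i (pw.1 0 i * (b1 * m 0 i) + pw.2 0 i * (b2 * m 0 i)) - b.
  rewrite /affine /dot !mulr_sumr -big_split /=; congr (_ - _).
  by apply: eq_bigr => i _; ring.
rewrite !E /margin mulrDr mulr1 mulr_sumr.
have le1 (x y z : R) : `|y - z| <= e -> x * z - e * `|x| <= x * y.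
  move=> yz; rewrite -subr_ge0.
  have : - (x * (y - z)) <= `|x| * e.
    apply: le_trans (ler_norm _) _; rewrite normrN normrM.
    by rewrite ler_wpM2l.
  by rewrite mulrBr [_ * e]mulrC; lra.
have s : \sum_i (pw.1 0 i * (a1 * n 0 i) + pw.2 0 i * (a2 * n 0 i)) -
   \sum_i e * (`|pw.1 0 i| + `|pw.2 0 i|) <=
   \sum_i (pw.1 0 i * (a1' * n' 0 i) + pw.2 0 i * (a2' * n' 0 i)).
  rewrite -sumrB; apply: ler_sum => i _.
  by rewrite mulrDr opprD addrACA lerD// le1.
by move: h3; rewrite ler_norml => /andP[_]; lra.
Qed.

End HalfSpaces.

(** * The balance of a measure across a hyperplane *)

Section Balance.
Variables (R : realType) (d : nat).
Local Notation V := 'rV[R]_d.+2.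
Variable mu : {finite_measure set (borel (line R d)) -> \bar R}.
Implicit Types (p w n : 'rV[R]_d) (c : R) (pw : 'rV[R]_d * 'rV[R]_d).

Definition rmass (A : set (borel (line R d))) : R := fine (mu A).

Lemma rmassE A : measurable A -> (rmass A)%:E = mu A.
Proof. by move=> mA; rewrite fineK// fin_num_measure. Qed.

Lemma rmass_le A B : measurable A -> measurable B -> A `<=` B -> rmass A <= rmass B.
Proof.
by move=> mA mB AB; rewrite -lee_fin !rmassE// le_measure ?inE.
Qed.

Lemma half_pos_bigcup a1 a2 n c :
  half_pos a1 a2 n c = \bigcup_k half_margin a1 a2 n c k.+1%:R^-1.
Proof.
apply/seteqP; split => [_ [pw /= apw <-]|_ [k _ [pw /= apw <-]]]; last first.
  exists pw => //=; apply: lt_le_trans apw _; rewrite gerBl.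
  by rewrite mulr_ge0// ltW// margin_gt0.
have e0 : 0 < affine a1 a2 n c pw / margin pw by rewrite divr_gt0// margin_gt0.
have [k _ kP] := near_infty_natSinv_lt (PosNum e0).
exists k => //; exists pw => //=; rewrite subr_gt0 -ltr_pdivlMr ?margin_gt0//.
exact: kP (leqnn k).
Qed.

(** Some [half_margin] has nearly the full measure of the half-space, and it is contained in all
    nearby half-spaces. *)
Lemma half_pos_lower a1 a2 n c eps : 0 < eps ->
  exists2 e, 0 < e & forall a1' a2' n' c',
    (forall i, `|a1' * n' 0 i - a1 * n 0 i| <= e) ->
    (forall i, `|a2' * n' 0 i - a2 * n 0 i| <= e) -> `|c' - c| <= e ->
    rmass (half_pos a1 a2 n c) - eps < rmass (half_pos a1' a2' n' c').
Proof.
move=> eps0; pose G k := half_margin a1 a2 n c k.+1%:R^-1.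
have mG k : measurable (G k) by exact: measurable_half_margin.
have cG : mu \o G @ \oo --> mu (half_pos a1 a2 n c).
  rewrite half_pos_bigcup; apply: nondecreasing_cvg_mu => //.
    exact: bigcup_measurable.
  move=> k l kl; apply/subsetPset => _ [pw /= apw <-]; exists pw => //=.
  apply: lt_le_trans apw _; rewrite lerD2l lerN2.
  apply: ler_wpM2r; first exact: ltW (margin_gt0 pw).
  by rewrite lef_pV2 ?posrE ?ltr0n// ler_nat ltnS.
move: cG; rewrite -rmassE; last exact: measurable_half_pos.
move=> /fine_cvgP[_] /cvgrPdist_lt /(_ _ eps0) [k _ /(_ k (leqnn k)) kP].
exists k.+1%:R^-1 => // a1' a2' n' c' h1 h2 h3.
have GP : G k `<=` half_pos a1' a2' n' c'.
  move=> _ [pw /= apw <-]; exists pw => //=; apply: lt_le_trans apw _.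
  exact: affine_perturb.
have := rmass_le (mG k) (measurable_half_pos _ _ _ _) GP.
by move: kP; rewrite ltr_norml /= -/(rmass (G k)) => /andP[_]; lra.
Qed.

Definition half_neg a1 a2 n c := half_pos (- a1) (- a2) n (- c).
Definition half_zero (a1 a2 : R) n c :=
  worldlines [set pw | affine a1 a2 n c pw = 0].

Lemma affineN a1 a2 n c pw : affine (- a1) (- a2) n (- c) pw = - affine a1 a2 n c pw.
Proof. by rewrite /affine; ring. Qed.

Lemma affine_opp_normal a1 a2 n c pw : affine a1 a2 (- n) c pw = affine (- a1) (- a2) n c pw.
Proof.
have dN p : dot p (- n) = - dot p n.
  by rewrite /dot -sumrN; apply: eq_bigr => i _; rewrite mxE mulrN.
by rewrite /affine !dN; ring.
Qed.

Lemma half_posI_neg a1 a2 n c : half_pos a1 a2 n c `&` half_neg a1 a2 n c = set0.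
Proof.
apply/seteqP; split => // _ [[[p w] /= h1 <-]].
by move=> /worldlinesE /=; rewrite affineN oppr_gt0 => /lt_trans /(_ h1); rewrite ltxx.
Qed.

Lemma half_zeroE a1 a2 n c : half_zero a1 a2 n c =
  worldlines setT `\` (half_pos a1 a2 n c `|` half_neg a1 a2 n c).
Proof.
apply/seteqP; split => [_ [[p w] /= h <-]|_ [[[p w] _ <-]] /not_orP[h1 h2]].
  split; first by exists (p, w).
  by case=> /worldlinesE /=; rewrite ?affineN h ?oppr0 ltxx.
exists (p, w) => //=; apply/eqP; rewrite eq_le !leNgt; apply/andP; split; apply/negP => h.
  by apply: h1; exact/worldlinesE.
by apply: h2; apply/worldlinesE => /=; rewrite affineN oppr_gt0.
Qed.

Lemma measurable_half_neg a1 a2 n c : measurable (half_neg a1 a2 n c).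
Proof. exact: measurable_half_pos. Qed.

Lemma measurable_half_zero a1 a2 n c : measurable (half_zero a1 a2 n c).
Proof.
rewrite half_zeroE; apply: measurableD; first exact: measurable_worldlinesT.
by apply: measurableU; exact: measurable_half_pos.
Qed.

Lemma rmassU A B : measurable A -> measurable B -> A `&` B = set0 ->
  rmass (A `|` B) = rmass A + rmass B.
Proof.
move=> mA mB AB; apply: EFin_inj; rewrite EFinD !rmassE ?measureU//.
exact: measurableU.
Qed.

Lemma rmass_halves_le a1 a2 n c :
  rmass (half_pos a1 a2 n c) + rmass (half_neg a1 a2 n c) <= rmass (worldlines setT).
Proof.
have mp := measurable_half_pos a1 a2 n c; have mn := measurable_half_neg a1 a2 n c.
rewrite -rmassU//; last exact: half_posI_neg.
apply: rmass_le; [exact: measurableU|exact: measurable_worldlinesT|].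
by move=> _ [] [pw _ <-]; exists pw.
Qed.

Definition bal a1 a2 n c := rmass (half_pos a1 a2 n c) - rmass (half_neg a1 a2 n c).

Lemma bal_opp a1 a2 n c : bal a1 a2 (- n) (- c) = - bal a1 a2 n c.
Proof.
rewrite /bal opprB /half_neg opprK; congr (rmass _ - rmass _).
  by congr worldlines; apply/funext => pw /=; rewrite affine_opp_normal.
by congr worldlines; apply/funext => pw /=; rewrite affine_opp_normal !opprK.
Qed.

Lemma bal_opp_dir a1 a2 n c : bal (- a1) (- a2) n c = - bal a1 a2 n (- c).
Proof. by rewrite /bal opprB /half_neg !opprK. Qed.

Section NullZero.
Variables (a1 a2 : R) (n : 'rV[R]_d) (c : R).
Hypothesis zero0 : mu (half_zero a1 a2 n c) = 0%E.

Lemma rmass_halves :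
  rmass (half_pos a1 a2 n c) + rmass (half_neg a1 a2 n c) = rmass (worldlines setT).
Proof.
have mp := measurable_half_pos a1 a2 n c; have mn := measurable_half_neg a1 a2 n c.
have mz := measurable_half_zero a1 a2 n c.
rewrite -rmassU//; last exact: half_posI_neg.
have -> : worldlines setT =
    (half_pos a1 a2 n c `|` half_neg a1 a2 n c) `|` half_zero a1 a2 n c.
  rewrite half_zeroE setDUK// => _ [] [pw _ <-]; by exists pw.
have mU : measurable (half_pos a1 a2 n c `|` half_neg a1 a2 n c) by exact: measurableU.
by apply: EFin_inj; rewrite !rmassE ?(measureU0 mU mz zero0)//; exact: measurableU.
Qed.


(** Neither open side loses more than [eps / 2]. As they fill the total mass at the null hyperplane
    and never exceed it nearby, neither gains more than [eps / 2]. *)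
Lemma bal_continuous eps : 0 < eps ->
  exists2 e, 0 < e & forall a1' a2' n' c',
    (forall i, `|a1' * n' 0 i - a1 * n 0 i| <= e) ->
    (forall i, `|a2' * n' 0 i - a2 * n 0 i| <= e) -> `|c' - c| <= e ->
    `|bal a1 a2 n c - bal a1' a2' n' c'| < eps.
Proof.
move=> eps0; have eps2 : 0 < eps / 2 by rewrite divr_gt0.
have [e1 e10 H1] := half_pos_lower a1 a2 n c eps2.
have [e2 e20 H2] := half_pos_lower (- a1) (- a2) n (- c) eps2.
exists (Num.min e1 e2); first by rewrite lt_min e10.
move=> a1' a2' n' c' h1 h2 h3.
have K1 : rmass (half_pos a1 a2 n c) - eps / 2 < rmass (half_pos a1' a2' n' c').
  apply: H1 => [i|i|]; [have := h1 i|have := h2 i|move: h3];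
  by rewrite le_min => /andP[].
have K2 : rmass (half_neg a1 a2 n c) - eps / 2 < rmass (half_neg a1' a2' n' c').
  apply: H2 => [i|i|]; [have := h1 i|have := h2 i|move: h3];
  by rewrite le_min => /andP[_]; rewrite ?mulNr -opprD normrN.
have := rmass_halves; have := rmass_halves_le a1' a2' n' c'.
rewrite /bal ltr_norml; lra.
Qed.

(** The closed sides weigh as much as the open ones. The factor [lam] normalises the equation of the
    hyperplane; a negative one exchanges the sides. *)
Lemma closed_halves (lam : R) (A B : set ('rV[R]_d * 'rV[R]_d)) : lam != 0 ->
  (forall pw, A pw <-> lam * affine a1 a2 n c pw <= 0) ->
  (forall pw, B pw <-> 0 <= lam * affine a1 a2 n c pw) ->
  bal a1 a2 n c = 0 -> phase mu A = phase mu B.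
Proof.
move=> lam0 AE BE /eqP; rewrite subr_eq0 => /eqP b0.
have mp := measurable_half_pos a1 a2 n c; have mn := measurable_half_neg a1 a2 n c.
have mz := measurable_half_zero a1 a2 n c.
have le_pos : mu (worldlines [set pw | 0 <= affine a1 a2 n c pw]) =
    mu (half_pos a1 a2 n c).
  rewrite -(measureU0 mp mz zero0); congr (mu _).
  apply/seteqP; split => [_ [pw /= h <-]|_ [] [pw /= h <-]].
  - move: h; rewrite le_eqVlt => /orP[/eqP h|h]; [right|left]; by exists pw.
  - by exists pw => //=; exact: ltW.
  - by exists pw => //=; rewrite h.
have le_neg : mu (worldlines [set pw | affine a1 a2 n c pw <= 0]) =
    mu (half_neg a1 a2 n c).
  rewrite -(measureU0 mn mz zero0); congr (mu _).
  apply/seteqP; split => [_ [pw /= h <-]|_ [] [pw /= h <-]].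
  - move: h; rewrite le_eqVlt => /orP[/eqP h|h]; [right|left]; exists pw => //=.
    by rewrite affineN oppr_gt0.
  - by exists pw => //=; move: h; rewrite affineN oppr_gt0 => /ltW.
  - by exists pw => //=; rewrite h.
have E : mu (worldlines [set pw | affine a1 a2 n c pw <= 0]) =
    mu (worldlines [set pw | 0 <= affine a1 a2 n c pw]).
  by rewrite le_pos le_neg -!rmassE// b0.
rewrite /phase -/(worldlines A) -/(worldlines B).
have [l0|l0] := ltP 0 lam.
  have -> : A = [set pw | affine a1 a2 n c pw <= 0].
    by apply/funext => pw; apply/propext; rewrite AE pmulr_rle0.
  have -> // : B = [set pw | 0 <= affine a1 a2 n c pw].
  by apply/funext => pw; apply/propext; rewrite BE pmulr_rge0.
have {}l0 : lam < 0 by rewrite lt_neqAle lam0.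
have -> : A = [set pw | 0 <= affine a1 a2 n c pw].
  by apply/funext => pw; apply/propext; rewrite AE nmulr_rle0.
have -> // : B = [set pw | affine a1 a2 n c pw <= 0].
by apply/funext => pw; apply/propext; rewrite BE nmulr_rge0.
Qed.

End NullZero.
End Balance.

(** * The theorem *)

Section NullHyperplane.
Variables (R : realType) (d : nat).
Local Notation V := 'rV[R]_d.+2.
Local Notation G := (orth_group R d.+2).
Local Notation tau := (time_ix d).
Local Notation hom := (hom_ix d).

(** Cramer's rule for the position, and below for the velocity, of the line whose plane is spanned
    by [x] and [y]. *)
Definition span_pos (x y : V) : 'rV[R]_d :=
  \row_i (pluecker tau (space_ix i) x y / hom_form x y).
Definition span_vel (x y : V) : 'rV[R]_d :=
  \row_i (pluecker (space_ix i) hom x y / hom_form x y).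

Lemma span_worldline (x y : V) : hom_form x y != 0 ->
  <<[:: vel_row (span_vel x y); pos_row (span_pos x y)]>>%VS = <<[:: x; y]>>%VS.
Proof.
set q := hom_form x y => q0.
(* The coefficients invert the minor [q]: they make the time and last coordinates [(1, 0)] here and
   [(0, 1)] in [posE]. *)
have velE : vel_row (span_vel x y) = (y 0 hom / q) *: x + (- x 0 hom / q) *: y.
  apply: row_ext => [i||]; rewrite !appendE !mxE -/q /pluecker; try by field.
  by rewrite -[LHS](mulfV q0) {1}/q /hom_form /pluecker; field.
have posE : pos_row (span_pos x y) = (- y 0 tau / q) *: x + (x 0 tau / q) *: y.
  apply: row_ext => [i||]; rewrite !appendE !mxE -/q /pluecker; try by field.
  by rewrite -[LHS](mulfV q0) {1}/q /hom_form /pluecker; field.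
have xE : x = x 0 tau *: vel_row (span_vel x y) + x 0 hom *: pos_row (span_pos x y).
  have qE : q = x 0 tau * y 0 hom - x 0 hom * y 0 tau by [].
  rewrite velE posE; apply/rowP => i; rewrite !mxE.
  transitivity (q * x 0 i / q); first by field.
  by rewrite {1}qE; field.
have yE : y = y 0 tau *: vel_row (span_vel x y) + y 0 hom *: pos_row (span_pos x y).
  have qE : q = x 0 tau * y 0 hom - x 0 hom * y 0 tau by [].
  rewrite velE posE; apply/rowP => i; rewrite !mxE.
  transitivity (q * y 0 i / q); first by field.
  by rewrite {1}qE; field.
apply/eqP; rewrite eqEsubv; apply/andP; split; apply/span_subvP => v;
  rewrite !inE => /orP[]/eqP->; apply/span2P.
- by exists (y 0 hom / q), (- x 0 hom / q).
- by exists (- y 0 tau / q), (x 0 tau / q).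
- by exists (x 0 tau), (x 0 hom).
- by exists (y 0 tau), (y 0 hom).
Qed.

Definition frame_line (u : G) : borel (line R d) :=
  let x := row ord0 (val u)^T in let y := row (lift ord0 ord0) (val u)^T in
  worldline (span_pos x y) (span_vel x y).

Definition transversal : set (borel G) := [set u | on_frame (@hom_form R d) (val u) != 0].

Lemma line_plane_frame (u : G) : transversal u ->
  line_plane (frame_line u) = grass2_orbit u.
Proof.
move=> u0; apply/val_inj; rewrite [RHS]val_grass2_orbit.
by rewrite [LHS]line_plane_worldline span_worldline.
Qed.

Lemma open_transversal : open (transversal : set G).
Proof.
rewrite (_ : transversal = ~` [set u : G | on_frame (@hom_form R d) (val u) = 0]).
  apply: closed_openC; apply: closed_eq0; apply: orth_frame_continuous.
  exact: frame_pluecker_continuous.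
by apply/seteqP; split => u /= /eqP.
Qed.

Lemma measurable_frame_line : measurable_fun transversal frame_line.
Proof.
have H := @measurability _ _ (borel G) (borel (line R d)) transversal frame_line
  (@open (line R d)).
apply: H => //.
move=> _ [_ [W oW <-] <-]; apply: borel_open.
rewrite (_ : _ `&` _ = (transversal : set G) `&` (@grass2_orbit R d @^-1` W)).
  by apply: openI; [exact: open_transversal|exact: oW].
by apply/seteqP; split => u [u0 /= uW]; split => //=;
  [rewrite -line_plane_frame|rewrite line_plane_frame].
Qed.

(** This turns the measure of a set of world lines into a Haar measure of frames. Two bases of one
    plane have proportional Pluecker coordinates, and [hom_form = 1] fixes the factor, so the frame
    determines position and velocity. *)
Lemma orbit_line_plane (B : set (borel (line R d))) : B `<=` worldlines setT ->
  @grass2_orbit R d @^-1` (@line_plane R d @` B) = transversal `&` frame_line @^-1` B.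
Proof.
move=> BW; apply/seteqP; split => [u [l Bl lu]|u [u0 Bu]]; last first.
  by exists (frame_line u) => //; exact: line_plane_frame.
have [[p w] _ /= lE] := BW _ Bl.
have := val_grass2_orbit u; rewrite -lu -lE line_plane_worldline.
set x := row ord0 _; set y := row (lift _ _) _ => E.
have /span2P[a [b XE]] : vel_row w \in <<[:: x; y]>>%VS.
  by rewrite -E; apply/span2P; exists 1, 0; rewrite scale1r scale0r addr0.
have /span2P[a' [b' YE]] : pos_row p \in <<[:: x; y]>>%VS.
  by rewrite -E; apply/span2P; exists 0, 1; rewrite scale1r scale0r add0r.
have := hom_worldline p w; rewrite /hom_form XE YE pluecker_comb => h1.
have q0 : pluecker tau hom x y != 0.
  by apply/eqP => q0; move/eqP: h1; rewrite q0 mulr0 eq_sym oner_eq0.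
have dE : a * b' - b * a' = (pluecker tau hom x y)^-1.
  by apply: (mulIf q0); rewrite h1 mulVf.
have -> : frame_line u = worldline p w; last by rewrite lE.
rewrite /frame_line -/x -/y; congr worldline; apply/rowP => i; rewrite mxE.
  transitivity (pluecker tau (space_ix i) (vel_row w) (pos_row p)).
    by rewrite XE YE pluecker_comb dE mulrC.
  by rewrite /pluecker !appendE; ring.
transitivity (pluecker (space_ix i) hom (vel_row w) (pos_row p)).
  by rewrite XE YE pluecker_comb dE mulrC.
by rewrite /pluecker !appendE; ring.
Qed.

Variables (haar : probability (borel G) R) (haarP : is_haar haar).

(** If the line of a transversal frame lies on the hyperplane, [incidence] vanishes at the frame by
    a change of basis, and [ae_incidence] makes this negligible. All measurable parts [B] are
    treated because the absolute continuity in [half_zero_null] asks for each of them. *)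
Lemma line_measure_hyperplane a1 a2 n c B :
  (n != 0) || (c != 0) -> (a1 != 0) || (a2 != 0) ->
  measurable B -> B `<=` half_zero a1 a2 n c -> line_measure haar B = 0%E.
Proof.
move=> nc0 a0 mB B0.
have BW : B `<=` worldlines setT by move=> l /B0[pw _ <-]; exists pw.
rewrite /line_measure /grass2_measure /pushforward orbit_line_plane//.
apply: measure_negligible.
  apply: measurable_frame_line => //; apply: borel_open; exact: open_transversal.
apply: negligibleS (ae_incidence haarP nc0 a0) => u [u0 Bu] /= H.
have /eqP := u0; apply; apply: H; rewrite /on_frame.
move: (B0 _ Bu); rewrite /frame_line => /worldlinesE /=.
rewrite /affine /= -incidence_worldline; move/eqP: u0; rewrite /on_frame.
set x := row ord0 _; set y := row (lift _ _) _ => /eqP u0 i0.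
have /span2P[a [b XE]] : x \in <<[:: vel_row (span_vel x y); pos_row (span_pos x y)]>>%VS.
  by rewrite span_worldline//; apply/span2P; exists 1, 0; rewrite scale1r scale0r addr0.
have /span2P[a' [b' YE]] : y \in <<[:: vel_row (span_vel x y); pos_row (span_pos x y)]>>%VS.
  by rewrite span_worldline//; apply/span2P; exists 0, 1; rewrite scale1r scale0r add0r.
rewrite [X in incidence _ _ _ _ X _]XE [X in incidence _ _ _ _ _ X]YE.
by rewrite incidence_comb i0 mulr0.
Qed.


Lemma half_zero_null (mu : {finite_measure set (borel (line R d)) -> \bar R})
    a1 a2 n c : mu `<< line_measure haar ->
  (n != 0) || (c != 0) -> (a1 != 0) || (a2 != 0) ->
  mu (half_zero a1 a2 n c) = 0%E.
Proof.
move=> ac nc0 a0; apply: (ac (half_zero a1 a2 n c)) => //.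
  by move=> B mB B0; exact: line_measure_hyperplane nc0 a0 mB B0.
exact: measurable_half_zero.
Qed.

End NullHyperplane.

(** * The odd map of imbalances *)

Section Imbalance.
Variables (R : realType) (d : nat).
Local Notation V := 'rV[R]_d.+2.
Variable haar : probability (borel (orth_group R d.+2)) R.
Hypothesis haarP : is_haar haar.
Variable mu : 'I_d.+1 -> {finite_measure set (borel (line R d)) -> \bar R}.
Hypothesis mu_ac : forall i, mu i `<< line_measure haar.

Definition normal_of (v : V) : 'rV[R]_d := \row_j spatial v (lift ord0 j).

Definition imbalance (v : V) (i : 'I_d.+1) : R :=
  bal (mu i) (cos (pi * v 0 ord0)) (sin (pi * v 0 ord0)) (normal_of v) (spatial v ord0).

Lemma cos_sin_neq0 (t : R) : (cos t != 0) || (sin t != 0).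
Proof.
rewrite -negb_and; apply/negP => /andP[/eqP c0 /eqP s0].
by have := cos2Dsin2 t; rewrite c0 s0 expr0n addr0 => /eqP; rewrite eq_sym oner_eq0.
Qed.

Lemma normal_neq0 v : (exists i, spatial v i != 0) ->
  (normal_of v != 0) || (spatial v ord0 != 0).
Proof.
case=> i; case: (unliftP ord0 i) => [j ->|-> ->]; last exact: orbT.
move=> vj; apply/orP; left; apply/eqP => /rowP /(_ j); rewrite !mxE => /eqP.
by rewrite (negbTE vj).
Qed.

Lemma normal_antipode v : normal_of (antipode v) = - normal_of v.
Proof. by apply/rowP => j; rewrite !mxE spatial_antipode. Qed.

Lemma imbalance_antipode v i : imbalance (antipode v) i = - imbalance v i.
Proof.
rewrite /imbalance normal_antipode spatial_antipode bal_opp.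
by rewrite [antipode v 0 ord0]mxE mul1r.
Qed.

(** A shift by 1 negates [(a1, a2)], which amounts to the opposite side of the hyperplane with
    [- c]; [mirror] negates the coordinate that carries [c]. *)
Lemma imbalance_advance v i : imbalance (advance v) i = - imbalance (mirror v) i.
Proof.
have tE : pi * advance v 0 ord0 = pi * v 0 ord0 + pi.
  by rewrite !mxE !eqxx /= mulrDr mulr1.
have nE : normal_of (advance v) = normal_of v.
  by apply/rowP => j; rewrite !mxE spatial_advance.
have nmE : normal_of (mirror v) = normal_of v.
  by apply/rowP => j; rewrite !mxE spatial_scale (inj_eq lift_inj) mul1r.
rewrite /imbalance tE nE nmE spatial_advance cosDpi sinDpi bal_opp_dir.
by rewrite /mirror spatial_scale eqxx mulN1r [rescale _ _ 0 ord0]mxE mul1r.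
Qed.

Lemma imbalance_continuous v i : (exists i, spatial v i != 0) ->
  {for v, continuous (imbalance ^~ i)}.
Proof.
move=> v0; apply: (@cvgrPdist_lt _ _ _ _ (nbhs_filter v) _ _).2 => eps eps0.
have zero0 := half_zero_null haarP (mu_ac i) (normal_neq0 v0) (cos_sin_neq0 (pi * v 0 ord0)).
have [e e0 H] := bal_continuous zero0 eps0.
have ct : continuous (fun w : V => pi * w 0 ord0 : R).
  by apply: continuous_funZ; exact: coord_continuous.
have cn j : continuous (fun w : V => normal_of w 0 j).
  rewrite (_ : (fun w : V => _) = fun w => w 0 (lift ord0 (lift ord0 j))).
    exact: coord_continuous.
  by apply/funext => w; rewrite mxE.
have close (f : V -> R) : continuous f -> \forall w \near v, `|f w - f v| <= e.
  move=> cf; have := (@cvgrPdist_lt _ _ _ (nbhs v) (nbhs_filter v) f (f v)).1 (cf v) e e0.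
  by apply: (@filterS _ _ (nbhs_filter v)) => w; rewrite distrC => /ltW.
have h1 : \forall w \near v, forall j, `|cos (pi * (w : V) 0 ord0) * normal_of w 0 j -
    cos (pi * v 0 ord0) * normal_of v 0 j| <= e.
  apply: (filter_forall (nbhs_filter v)) => j.
  apply: (close (fun w => cos (pi * w 0 ord0) * normal_of w 0 j)).
  apply: continuous_funM; last exact: cn.
  move=> w; apply: (@continuous_comp _ _ _ (fun w : V => pi * w 0 ord0 : R) cos).
    exact: ct.
  exact: continuous_cos.
have h2 : \forall w \near v, forall j, `|sin (pi * (w : V) 0 ord0) * normal_of w 0 j -
    sin (pi * v 0 ord0) * normal_of v 0 j| <= e.
  apply: (filter_forall (nbhs_filter v)) => j.
  apply: (close (fun w => sin (pi * w 0 ord0) * normal_of w 0 j)).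
  apply: continuous_funM; last exact: cn.
  move=> w; apply: (@continuous_comp _ _ _ (fun w : V => pi * w 0 ord0 : R) sin).
    exact: ct.
  exact: continuous_sin.
have h3 : \forall w \near v, `|spatial w ord0 - spatial v ord0| <= e.
  by apply: (close (fun w => spatial w ord0)); exact: coord_continuous.
by apply: (@filterS3 _ _ (nbhs_filter v) _ _ _ _ _ h1 h2 h3) => w; exact: H.
Qed.

Lemma bal_eq0_conclusion a1 a2 n c : n != 0 -> (a1 != 0) || (a2 != 0) ->
  (forall i, bal (mu i) a1 a2 n c = 0) ->
  (exists v : 'rV[R]_d, dot v v = 1 /\
     exists m : R, forall i, is_median_speed (mu i) v m) \/
  (exists (t : R) (n : 'rV[R]_d) (c : R), n != 0 /\
     forall i, at_time (mu i) t [set x | dot x n <= c] =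
               at_time (mu i) t [set x | c <= dot x n]).
Proof.
move=> n0 a0 b0.
have zero0 i : mu i (half_zero a1 a2 n c) = 0%E.
  by apply: (half_zero_null haarP (mu_ac i) _ a0); rewrite n0.
have [a10|a10] := eqVneq a1 0; last first.
  (* Division by [a1] turns the affine function into the equation of a hyperplane for the position
     at time [a2 / a1]. *)
  right; exists (a2 / a1), n, (c / a1); split=> // i.
  have E pw : dot (pw.1 + (a2 / a1) *: pw.2) n - c / a1 =
      a1^-1 * affine a1 a2 n c pw.
    have -> : dot (pw.1 + (a2 / a1) *: pw.2) n = dot pw.1 n + a2 / a1 * dot pw.2 n.
      rewrite /dot mulr_sumr -big_split; apply: eq_bigr => j _ /=.
      by rewrite !mxE; ring.
    by rewrite /affine; field.
  apply: (closed_halves (zero0 i) (lam := a1^-1)) => [|pw|pw|//].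
  - by rewrite invr_eq0.
  - by rewrite -E subr_le0.
  - by rewrite -E subr_ge0.
left; move: a0; rewrite a10 eqxx /= => a20.
have nn : 0 < dot n n.
  have sq j : 0 <= n 0 j * n 0 j by rewrite -expr2 sqr_ge0.
  rewrite lt_neqAle sumr_ge0 ?andbT// eq_sym.
  apply: contra n0 => /eqP nn0; apply/eqP/rowP => j; rewrite mxE; apply/eqP.
  by rewrite -sqrf_eq0 expr2 (psumr_eq0P (fun k _ => sq k) nn0).
pose r := Num.sqrt (dot n n); have r0 : 0 < r by rewrite sqrtr_gt0.
have dZ (w : 'rV[R]_d) : dot w (r^-1 *: n) = r^-1 * dot w n.
  by rewrite /dot mulr_sumr; apply: eq_bigr => j _; rewrite mxE mulrCA.
exists (r^-1 *: n); split.
  have dC (x y : 'rV[R]_d) : dot x y = dot y x.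
    by apply: eq_bigr => j _; rewrite mulrC.
  rewrite dZ dC dZ mulrA -expr2 exprVn sqr_sqrtr ?ltW// mulVf// gt_eqF//.
(* With [a1 = 0] only velocities matter; [a2] and the length [r] of the normal are divided out. *)
exists (c / (a2 * r)) => i; rewrite /is_median_speed.
have E pw : dot pw.2 (r^-1 *: n) - c / (a2 * r) = (a2 * r)^-1 * affine a1 a2 n c pw.
  by rewrite /affine a10 dZ mul0r add0r; field; rewrite a20 gt_eqF.
apply: (closed_halves (zero0 i) (lam := (a2 * r)^-1)) => [|pw|pw|//].
- by rewrite invr_eq0 mulf_neq0// gt_eqF.
- by rewrite -E subr_le0.
- by rewrite -E subr_ge0.
Qed.

(** With zero normal the affine function is the constant [- c], so one side is everything and the
    other is empty. *)
Lemma worldlines_null v : normal_of v = 0 -> spatial v ord0 != 0 ->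
  forall i, imbalance v i = 0 -> rmass (mu i) (worldlines setT) = 0.
Proof.
move=> n0 c0 i; rewrite /imbalance n0.
have aff a1 a2 c (pw : 'rV[R]_d * 'rV[R]_d) : affine a1 a2 0 c pw = - c.
  have d0 (x : 'rV[R]_d) : dot x 0 = 0.
    by rewrite /dot big1// => j _; rewrite mxE mulr0.
  by rewrite /affine !d0 !mulr0 addr0 add0r.
have hp (a1 a2 c : R) : half_pos a1 a2 (0 : 'rV[R]_d) c =
    if c < 0 then worldlines setT else set0.
  rewrite /half_pos (_ : mkset _ = [set _ | c < 0]); last first.
    by apply/funext => pw /=; rewrite aff oppr_gt0.
  case: ifP => cn0; first by congr worldlines; apply/seteqP; split.
  by apply/seteqP; split => // l [pw /=]; rewrite ?cn0.
rewrite /bal /half_neg !hp oppr_lt0.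
have m0 : rmass (mu i) set0 = 0 by rewrite /rmass measure0.
by case: ltgtP c0 => // _ _; rewrite m0 ?sub0r ?subr0 // => /eqP; rewrite oppr_eq0 => /eqP.
Qed.

End Imbalance.

Theorem theorem5p1 (R : realType) (d : nat) (hd : odd d)
    (haar : probability (borel (orth_group R d.+2)) R) (haarP : is_haar haar)
    (mu : 'I_d.+1 -> {finite_measure set (borel (line R d)) -> \bar R})
    (mu_ac : forall i, mu i `<< line_measure haar) :
  (exists v : 'rV[R]_d, dot v v = 1 /\
     exists m : R, forall i, is_median_speed (mu i) v m) \/
  (exists (t : R) (n : 'rV[R]_d) (c : R), n != 0 /\
     forall i, at_time (mu i) t [set x | dot x n <= c] =
               at_time (mu i) t [set x | c <= dot x n]).
Proof.
have [v v0 Fv] := @odd_map_zero R d (imbalance mu) hd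
  (fun v v0 i => imbalance_continuous haarP mu_ac v0)
  (imbalance_antipode mu) (imbalance_advance mu).
have [n0|n0] := eqVneq (normal_of v) 0; last first.
  apply: (bal_eq0_conclusion haarP mu_ac n0 (cos_sin_neq0 (pi * v 0 ord0))).
  exact: Fv.
have c0 : spatial v ord0 != 0 by have := normal_neq0 v0; rewrite n0 eqxx.
have mass0 i := worldlines_null n0 c0 (Fv i).
(* An odd [d] is positive, so there is a first basis vector to serve as a normal. *)
case: d hd haar haarP mu mu_ac v v0 Fv n0 c0 mass0 => // d _ haar haarP mu mu_ac.
move=> v _ _ _ _ mass0.
(* All measures vanish on world lines, so any hyperplane balances them; this one lives at time 0. *)
apply: (@bal_eq0_conclusion _ _ haar haarP mu mu_ac 1 0 (delta_mx 0 ord0) 0).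
- by apply/eqP => /rowP /(_ ord0); rewrite !mxE => /eqP; rewrite oner_eq0.
- by rewrite oner_eq0.
- have half0 i a1 a2 n c : rmass (mu i) (half_pos a1 a2 n c) = 0.
    apply/eqP; rewrite eq_le -{1}(mass0 i) fine_ge0 ?andbT//.
    apply: rmass_le; [exact: measurable_half_pos|exact: measurable_worldlinesT|].
    by move=> _ [pw _ <-]; exists pw.
  by move=> i; rewrite /bal !half0 subrr.
Qed.
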